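(* Let $p$ be a prime with $p\equiv 1\pmod 4$, and write $p=a^2+b^2$ with $a,b\in\mathbb{Z}$ and $4\mid a-1$. Then $$\sum_{k=0}^{p-1}\frac{\binom{6k}{3k}\binom{3k}{k}}{864^k}\equiv \begin{cases} 2a-\dfrac{p}{2a}\pmod{p^2} & \text{if } p\equiv 1\pmod{12} \text{ and } 3\nmid a,\\[2mm] -2a+\dfrac{p}{2a}\pmod{p^2} & \text{if } p\equiv 1\pmod{12}\text{ and } 3\mid a,\\[2mm] 2b-\dfrac{p}{2b}\pmod{p^2} & \text{if } p\equiv 5\pmod{12}\text{ and } 3\mid a-b.\end{cases}$$
   Context: Congruences modulo $p^2$ are taken in the ring $\mathbb{Z}_p$ of rational numbers whose denominator is coprime to $p$: for $u,v$ in this ring, $u\equiv v\pmod{p^2}$ means $(u-v)/p^2$ lies in this ring. *)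

(* Defs.v *)
From HB Require Import structures.
From mathcomp Require Import all_boot all_order all_algebra.

Set Implicit Arguments.
Unset Strict Implicit.
Unset Printing Implicit Defensive.

Import Order.TTheory GRing.Theory Num.Theory.
Local Open Scope ring_scope.

(* Membership in the ring Z_p of rationals with denominator coprime to p;
   denq x is the denominator of x in lowest terms. *)
Definition pintegral (p : nat) (x : rat) : bool := coprime p `|denq x|%N.

(* Congruence modulo p^2 in Z_p; u and v are required to lie in Z_p. *)
Definition congr_p2 (p : nat) (u v : rat) : Prop :=
  [/\ pintegral p u, pintegral p v & pintegral p ((u - v) / p%:R ^+ 2)].

(* Main.v *)
From HB Require Import structures.
Require Import Defs.
From mathcomp Require Import all_boot all_order all_algebra.
From mathcomp Require Import zify ring finfield cyclic.

(** Write p = 4m + 1 = 12l + u with u = 1 or u = 5, and work in Z/p^2.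

The quotient binom(6k,3k) binom(3k,k) / 432^k equals binom(r,k) binom(-1-r,k) for
r = -1/6 and for r = -5/6, so the sum is a truncated value at 0 of the Legendre function
P_r.  The three-term recurrence of the Legendre functions survives truncation at k = p
up to a boundary term which vanishes modulo p^2 (leg_telescope, leg_trunc_rec).  It
lowers r = -u/6 in steps of 2 down to -p/6, where the sum is elementary
(leg_trunc_base), and exhibits the sum as a quotient of products over two arithmetic
progressions of difference 12.  Modulo p^2 such a product is a quotient of factorials
times a factor 1 + p x, with x a difference of harmonic numbers (prod_progression).
Sorting the factors of a factorial by their residue modulo 3, an elementary form of the
multiplication formula of the Gamma function, turns the result into
    (-1)^l 3^(pm) B   with   B = binom(2m,m) (1 - p (H_2m - H_m) / 2),
H_n being the harmonic numbers (progression_quotient_eq).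

The number B is a Jacobi sum, as in the theorem of Chowla, Dwork and Evans.  Let chi be
a quartic character of F_p with values in Z[i], psi = chi^2, and J the sum of
chi(x) psi(1 - x).  Teichmueller representatives define a ring morphism from Z[i] to
Z/p^2; expanding 1 - T by the binomial theorem shows that it maps J to -(-1)^m B
(jacobi_sum_teich), and it maps the conjugate of chi(3) to 3^(pm).  Hence the sum is the
image of an explicit Gaussian integer z, a unit times J (leg_trunc_gauss).

It remains to identify z.  The norm of J is p (jacobi_norm), and J = -p modulo 2 + 2i
(jac_normal); since p is a sum of two squares in essentially one way, -(-1)^m J is
a + b i or a - b i (normalized_jacobi).  Counting on x + y + z = 1 modulo 3, where the
cyclic permutation of the coordinates has the only fixed point x = y = z = 1/3, gives
J^2 = psi(2) chi(3) modulo 3 (jacobi_sq_mod3); as psi(2) = (-1)^m (psi_two), chi(3) is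
determined by a and b modulo 3: this is the quartic reciprocity law for the prime 3.  In the three cases of
the theorem the real part c of z turns out to be a, -a and b (gint_sq_mod3).  Finally
the images x and y of z and of its conjugate satisfy x y = p and x + y = 2c with x
invertible, so y^2 = 0 and x = 2c - p / (2c) (gev_trace). *)

Set Implicit Arguments.
Unset Strict Implicit.
Unset Printing Implicit Defensive.

Import Order.TTheory GRing.Theory Num.Theory.
Local Open Scope ring_scope.

(** * Factorials, harmonic numbers and arithmetic progressions modulo p^2 *)

(** The two hypotheses are all that is used of Z/p^2: p squares to zero and the
    positive integers below p are invertible. *)
Section FirstOrder.
Variables (R : comUnitRingType) (p : nat).
Hypothesis p_sq0 : p%:R * p%:R = 0 :> R.
Hypothesis unit_lt_p : forall k, (0 < k < p)%N -> (k%:R : R) \is a GRing.unit.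

(** The map x |-> 1 + p x turns sums into products because p^2 = 0; first-order
    corrections to congruences modulo p are all recorded as values of eps. *)
Definition eps (x : R) : R := 1 + p%:R * x.

Definition harm (n : nat) : R := \sum_(i < n) i.+1%:R^-1.

Lemma harm0 : harm 0 = 0.
Proof. by rewrite /harm big_ord0. Qed.

Lemma harmS n : harm n.+1 = harm n + n.+1%:R^-1.
Proof. by rewrite /harm big_ord_recr. Qed.

Lemma sign_sq n : (-1) ^+ n * (-1) ^+ n = 1 :> R.
Proof. by rewrite -expr2 sqrr_sign. Qed.

Lemma eps0 : eps 0 = 1.
Proof. by rewrite /eps mulr0 addr0. Qed.

Lemma epsD x y : eps (x + y) = eps x * eps y.
Proof.
rewrite /eps; transitivity (1 + p%:R * (x + y) + p%:R * p%:R * (x * y)); last by ring.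
by rewrite p_sq0 mul0r addr0.
Qed.

Lemma epsN x : eps (- x) * eps x = 1.
Proof. by rewrite -epsD addNr eps0. Qed.

Lemma eps_unit x : eps x \is a GRing.unit.
Proof. by apply/unitrPr; exists (eps (- x)); rewrite mulrC epsN. Qed.

Lemma epsX x n : eps x ^+ n = eps (x *+ n).
Proof. by elim: n => [|n IHn]; rewrite ?eps0 // exprS IHn mulrS epsD. Qed.

Lemma eps_eq x y : p%:R * x = p%:R * y -> eps x = eps y.
Proof. by rewrite /eps => ->. Qed.

Lemma unit_fact n : (n < p)%N -> (n`!%:R : R) \is a GRing.unit.
Proof.
elim: n => [|n IHn] lt_n_p; first by rewrite unitr1.
by rewrite factS natrM unitrM unit_lt_p // IHn // ltnW.
Qed.

(** Each factor d j + r = c p - d (N - j) is -d (N - j) up to a factor of the form eps,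
    so the product is that of N, N - 1, ..., N - k + 1 and the corrections add up to a
    difference of harmonic numbers. *)
Lemma prod_progression (d r c N k : nat) :
    (d%:R : R) \is a GRing.unit -> (d * N + r = c * p)%N ->
    (k <= N)%N -> (N < p)%N ->
  (\prod_(j < k) (d * j + r)%:R) * (N - k)`!%:R =
  (- d%:R) ^+ k * N`!%:R * eps (- (c%:R / d%:R * (harm N - harm (N - k)))) :> R.
Proof.
move=> Ud def_r le_kN lt_Np; elim: k le_kN => [|k IHk] lt_kN.
  by rewrite big_ord0 subn0 subrr mulr0 oppr0 eps0 expr0 mulr1 mul1r.
have [n def_n] : exists n, (N - k.+1 = n)%N by exists (N - k.+1)%N.
have {IHk} := IHk (ltnW lt_kN).
have -> : (N - k = n.+1)%N by lia.
rewrite def_n factS harmS natrM => IHk.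
have Un : (n.+1%:R : R) \is a GRing.unit by apply: unit_lt_p; lia.
apply: (mulrI Un); rewrite big_ord_recr /=.
have -> : ((d * k + r)%:R : R) = c%:R * p%:R - d%:R * n.+1%:R.
  by apply/eqP; rewrite eq_sym subr_eq -!natrM -natrD -def_r; apply/eqP; congr _%:R; nia.
transitivity ((\prod_(j < k) (d * j + r)%:R * (n.+1%:R * n`!%:R)) *
              (c%:R * p%:R - d%:R * n.+1%:R) : R); first by ring.
rewrite {}IHk.
have -> : - (c%:R / d%:R * (harm N - harm n)) =
   - (c%:R / d%:R * (harm N - (harm n + n.+1%:R^-1))) + - (c%:R / d%:R / n.+1%:R) :> R by ring.
rewrite epsD exprS.
have -> : c%:R * p%:R - d%:R * n.+1%:R = - d%:R * n.+1%:R * eps (- (c%:R / d%:R / n.+1%:R)) :> R.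
  rewrite /eps.
  have -> : - d%:R * n.+1%:R * (1 + p%:R * - (c%:R / d%:R / n.+1%:R)) = 
     p%:R * c%:R * (d%:R / d%:R) * (n.+1%:R / n.+1%:R) - d%:R * n.+1%:R :> R by ring.
  by rewrite !divrr // !mulr1 mulrC.
by ring.
Qed.

Lemma unit_addp (x : R) : x \is a GRing.unit -> forall y, x + p%:R * y \is a GRing.unit.
Proof.
move=> Ux y; have -> : x + p%:R * y = x * eps (x^-1 * y).
  rewrite /eps mulrDr mulr1; congr (_ + _).
  by rewrite mulrCA mulVKr.
by rewrite unitrM Ux eps_unit.
Qed.

(** Once multiplied by p, inverses depend on their argument modulo p only. *)
Lemma mulp_inv_addp (x y : R) : x \is a GRing.unit ->
  p%:R * (x + p%:R * y)^-1 = p%:R * x^-1 :> R.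
Proof.
move=> Ux; have Uxy := unit_addp Ux y; apply: (mulIr Ux); apply: (mulIr Uxy).
transitivity (p%:R * x * ((x + p%:R * y)^-1 * (x + p%:R * y))); first by ring.
transitivity (p%:R * (x + p%:R * y) * (x^-1 * x)); last by ring.
rewrite !mulVr // !mulr1 mulrDr mulrA p_sq0 mul0r addr0 //.
Qed.

Lemma sum_inv_progression (d r c N k : nat) :
    (d%:R : R) \is a GRing.unit -> (d * N + r = c * p)%N ->
    (k <= N)%N -> (N < p)%N ->
  p%:R * (\sum_(j < k) (d * j + r)%:R^-1) =
  - (p%:R / d%:R * (harm N - harm (N - k))) :> R.
Proof.
move=> Ud def_r le_kN lt_Np; elim: k le_kN => [|k IHk] lt_kN.
  by rewrite big_ord0 subn0 subrr !mulr0 oppr0.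
rewrite big_ord_recr mulrDr {}IHk; last exact: ltnW.
have [n def_n] : exists n, (N - k.+1 = n)%N by exists (N - k.+1)%N.
have -> : (N - k = n.+1)%N by lia.
rewrite def_n harmS /=.
have Un : (n.+1%:R : R) \is a GRing.unit by apply: unit_lt_p; lia.
have -> : ((d * k + r)%:R : R) = - (d%:R * n.+1%:R) + p%:R * c%:R.
  by apply/eqP; rewrite addrC eq_sym subr_eq -!natrM -natrD mulnC -def_r; apply/eqP; congr _%:R; nia.
rewrite mulp_inv_addp ?unitrN ?unitrM ?Ud // invrN invrM //; ring.
Qed.

(** The first-order form of the symmetry x |-> p - x of the product defining (p - 1)!; it
    plays the part of the reflection formula of the Gamma function. *)
Lemma fact_reflect k : (k < p)%N ->
  (p.-1 - k)`!%:R * k`!%:R = (-1) ^+ k * p.-1`!%:R * eps (harm k) :> R.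
Proof.
move=> lt_kp; have [n def_p] : exists n, (p = n.+1 + k)%N by exists (p.-1 - k)%N; lia.
have := @prod_progression 1 n.+1 1 k k (unitr1 R).
rewrite !mul1n addnC -def_p => /(_ erefl (leqnn _) lt_kp).
rewrite subnn mulr1 harm0 subr0 divr1 mul1r => prodE.
have -> : (p.-1 - k = n)%N by lia.
have -> : p.-1`!%:R = n`!%:R * \prod_(j < k) (1 * j + n.+1)%:R :> R.
  have -> : (p.-1 = n + k)%N by lia.
  elim: (k) => [|j IHj]; first by rewrite big_ord0 mulr1 addn0.
  by rewrite addnS factS natrM IHj big_ord_recr /= mulrCA [X in _ * X]mulrC; congr (_ * (_ * _%:R)); lia.
rewrite prodE; transitivity (n`!%:R * k`!%:R * ((-1) ^+ k * (-1) ^+ k) * (eps (- harm k) * eps (harm k)) : R); last by ring.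
by rewrite epsN sign_sq !mulr1.
Qed.

Lemma harm_reflect k : (2 < p)%N -> (k < p)%N -> p%:R * harm (p.-1 - k) = p%:R * harm k.
Proof.
move=> p_gt2 lt_kp; have U2 : (2%:R : R) \is a GRing.unit by apply: unit_lt_p; lia.
have sumE j : (j < p)%N -> p%:R * harm j = - (p%:R * (harm p.-1 - harm (p.-1 - j))).
  move=> lt_jp; have := @sum_inv_progression 1 1 1 p.-1 j (unitr1 R).
  rewrite divr1 => <- //; try lia.
  by congr (_ * _); apply: eq_bigr => i _; rewrite mul1n addn1.
suff harm_p : p%:R * harm p.-1 = 0 by rewrite [RHS]sumE // mulrBr harm_p sub0r opprK.
have := sumE p.-1; rewrite subnn harm0 subr0 => /(_ ltac:(lia)) /eqP.
rewrite -addr_eq0 -mulr2n => /eqP eq0.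
apply: (mulrI U2); rewrite mulr0. rewrite -[2%:R]/(1 + 1) mulrDl mul1r. exact: eq0.
Qed.

Lemma eps_eq_mul (k : nat) x y : (k%:R : R) \is a GRing.unit ->
  p%:R * (k%:R * x) = p%:R * (k%:R * y) -> eps x = eps y.
Proof.
by move=> Uk eq_xy; apply: eps_eq; apply: (mulrI Uk); rewrite mulrCA eq_xy mulrCA.
Qed.

(** Compare two evaluations of (p - 1)!: the reflection of M!^2, and the product of its
    even and odd factors.  In other words H_M is -2 times the Fermat quotient of 2. *)
Lemma two_power_eps M : p = (2 * M).+1 -> (0 < M)%N ->
  2%:R ^+ p.-1 = eps (- (harm M / 2%:R)) :> R.
Proof.
move=> def_p M_gt0; have U2 : (2%:R : R) \is a GRing.unit by apply: unit_lt_p; lia.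
have UW : (p.-1`!%:R : R) \is a GRing.unit by apply: unit_fact; lia.
have := @prod_progression 2 1 1 M M U2; rewrite addn1 mul1n -def_p.
move=> /(_ erefl (leqnn _) ltac:(lia)); rewrite subnn mulr1 harm0 subr0 mul1r.
rewrite [2%:R^-1 * _]mulrC => oddE.
have factE : p.-1`!%:R = \prod_(j < M) (2 * j + 1)%:R * (2%:R ^+ M * M`!%:R) :> R.
  rewrite def_p /=; elim: (M) => [|j IHj]; first by rewrite big_ord0 !mulr1.
  rewrite mulnS !addSn add0n 3!factS !natrM IHj big_ord_recr /= addn1 exprS.
  have -> : (2 * j).+2%:R = 2%:R * j.+1%:R :> R by rewrite -natrM; congr _%:R; lia.
  by ring.
have := @fact_reflect M; have -> : (p.-1 - M = M)%N by lia.
move=> /(_ ltac:(lia)) reflE.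
have -> : (p.-1 = M + M)%N by lia.
apply: (mulIr (eps_unit (harm M / 2%:R))); rewrite epsN.
apply: (mulIr UW); rewrite mul1r {2}factE oddE.
transitivity (((-1) ^+ M * 2%:R ^+ M * 2%:R ^+ M * (M`!%:R * M`!%:R) * eps (- (harm M / 2%:R))) : R); last first.
  by rewrite [(- 2%:R) ^+ M]exprNn; ring.
rewrite reflE exprD.
transitivity (2%:R ^+ M * 2%:R ^+ M * ((-1) ^+ M * (-1) ^+ M) * p.-1`!%:R * (eps (harm M) * eps (- (harm M / 2%:R))) : R); last by ring.
rewrite sign_sq mulr1 -epsD -!mulrA [p.-1`!%:R * _]mulrC; do 3 congr (_ * _).
apply: (@eps_eq_mul 2) => //; congr (_ * _).
transitivity (harm M * (2%:R / 2%:R) ); first by ring.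
rewrite mulrDr mulrN [_ * (harm M / _)]mulrCA divrr // !mulr1 mulr_natl mulr2n addrK //.
Qed.

Lemma factE n : n`!%:R = \prod_(i < n) i.+1%:R :> R.
Proof. by elim: n => [|n IHn]; rewrite ?big_ord0 // big_ord_recr factS natrM IHn mulrC. Qed.

(** Separate the even and odd factors of (2m)!; modulo p this is the value (-1)^m of the
    Legendre symbol of 2. *)
Lemma two_power_quarter m : p = (4 * m).+1 -> (0 < m)%N ->
  2%:R ^+ (2 * m) = (-1) ^+ m * eps ((harm (2 * m) - harm m) / 2%:R) :> R.
Proof.
move=> def_p m_gt0; have U2 : (2%:R : R) \is a GRing.unit by apply: unit_lt_p; lia.
have U2m : ((2 * m)`!%:R : R) \is a GRing.unit by apply: unit_fact; lia.
have := @prod_progression 2 1 1 (2 * m) m U2; rewrite mulnA addn1 mul1n -def_p.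
have -> : (2 * m - m = m)%N by lia.
move=> /(_ erefl ltac:(lia) ltac:(lia)); rewrite mul1r [2%:R^-1 * _]mulrC => oddE.
have fact2 : (2 * m)`!%:R = \prod_(j < m) (2 * j + 1)%:R * m`!%:R * 2%:R ^+ m :> R.
  elim: (m) => [|j IHj]; first by rewrite big_ord0 !mulr1.
  rewrite mulnS !addSn add0n 3!factS !natrM IHj big_ord_recr /= addn1 exprS.
  have -> : (2 * j).+2%:R = 2%:R * j.+1%:R :> R by rewrite -natrM; congr _%:R; lia.
  by ring.
apply: (mulrI U2m); rewrite {2}fact2 oddE exprNn.
transitivity ((2 * m)`!%:R * (2%:R ^+ m * 2%:R ^+ m) : R).
  by rewrite -exprD; congr (_ * _ ^+ _); lia.
set X := (_ - _) / _.
transitivity ((2 * m)`!%:R * (2%:R ^+ m * 2%:R ^+ m) * ((-1) ^+ m * (-1) ^+ m) * (eps (- X) * eps X)); last by ring.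
by rewrite sign_sq epsN !mulr1.
Qed.

(** Stated for any commutative operation, since both factorials and harmonic numbers have
    to be sorted by residues modulo 3.  The class of v + 1, which in the application is
    that of p, comes before the other nonzero class. *)
Lemma big_split3 (T : Type) (idx : T) (op : Monoid.com_law idx) (F : nat -> T) k v :
    (v <= 1)%N ->
  \big[op/idx]_(i < 3 * k + v) F i.+1 =
  op (op (\big[op/idx]_(i < k) F (3 * i.+1)%N) (\big[op/idx]_(i < k) F (3 * i + v.+1)%N))
     (\big[op/idx]_(i < k + v) F (3 * i + (2 - v))%N).
Proof.
have split0 : \big[op/idx]_(i < 3 * k) F i.+1 =
  op (op (\big[op/idx]_(i < k) F (3 * i.+1)%N) (\big[op/idx]_(i < k) F (3 * i + 1)%N))
     (\big[op/idx]_(i < k) F (3 * i + 2)%N).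
  elim: k => [|k IHk]; first by rewrite muln0 !big_ord0 !Monoid.mul1m.
  rewrite mulnS !addSn add0n !big_ord_recr IHk /=.
  rewrite (_ : (3 * k + 1 = (3 * k).+1)%N) ?addn1 // (_ : (3 * k + 2 = (3 * k).+2)%N) ?addn2 //.
  rewrite (_ : (3 * k.+1 = (3 * k).+3)%N); last by lia.
  set A := \big[_/_]_(i < k) _; set B := \big[_/_]_(i < k) _; set C := \big[_/_]_(i < k) _.
  rewrite (Monoid.mulmACA op A) [RHS]Monoid.mulmACA -!Monoid.mulmA; do 3 congr (op _ _).
  by rewrite [RHS]Monoid.mulmC -Monoid.mulmA.
case: v => [|[|v]] // _; first by rewrite !addn0 split0.
rewrite !addn1 !big_ord_recr split0 /= -!Monoid.mulmA; congr (op _ _).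
rewrite [RHS]Monoid.mulmCA subSS subn0; congr (op _ (op _ (F _))) => /=; lia.
Qed.

(** With h = floor(p/3), h' = p - 1 - h, M = (p - 1)/2, s = M - l and s' = p - 1 - s, the
    primes congruent to 1 (v = 0) and to 5 (v = 1) modulo 12 are treated by the same
    formulas. *)
Section ResidueMod12.
Variables l v : nat.
Hypothesis v_le1 : (v <= 1)%N.
Hypothesis def_p : p = (12 * l + 4 * v).+1.
Hypothesis p_gt1 : (1 < p)%N.

Lemma unit3 : (3%:R : R) \is a GRing.unit.
Proof. by apply: unit_lt_p; lia. Qed.

Lemma unit2 : (2%:R : R) \is a GRing.unit.
Proof. by apply: unit_lt_p; lia. Qed.

Lemma unit12 : (12%:R : R) \is a GRing.unit.
Proof. by rewrite (natrM R 3 4) (natrM R 2 2) !unitrM unit3 unit2. Qed.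

Lemma inv3E : 3%:R^-1 = 4%:R / 12%:R :> R.
Proof. by apply: (mulrI unit3); rewrite divrr ?unit3 // mulrA -natrM divrr ?unit12. Qed.

Lemma inv2E : 2%:R^-1 = 6%:R / 12%:R :> R.
Proof. by apply: (mulrI unit2); rewrite divrr ?unit2 // mulrA -natrM divrr ?unit12. Qed.

Lemma eps_eq12 x y : p%:R * (12%:R * x) = p%:R * (12%:R * y) -> eps x = eps y.
Proof. exact: (eps_eq_mul unit12). Qed.

Variables h h' m M s s' : nat.
Hypotheses (def_h : h = (4 * l + v)%N) (def_h' : h' = (8 * l + 3 * v)%N).
Hypotheses (def_m : m = (3 * l + v)%N) (def_M : M = (6 * l + 2 * v)%N).
Hypotheses (def_s : s = (5 * l + 2 * v)%N) (def_s' : s' = (7 * l + 2 * v)%N).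

Lemma fact3 k : (3 * k + v)`!%:R =
  3%:R ^+ k * k`!%:R * (\prod_(j < k) (3 * j + v.+1)%:R)
  * (\prod_(j < k + v) (3 * j + (2 - v))%:R) :> R.
Proof.
rewrite factE (big_split3 _ (fun i => i%:R : R) k v_le1) /= factE; congr (_ * _ * _).
by rewrite -(card_ord k) -prodr_const card_ord -big_split; apply: eq_bigr => i _; rewrite natrM.
Qed.

(** This progression is the class of p modulo 3, hence runs through p - 3 h, p - 3 (h - 1)
    and so on. *)
Lemma progression1 k n : (k + n = h)%N -> (\prod_(j < k) (3 * j + v.+1)%:R) * n`!%:R =
  (- 3%:R) ^+ k * h`!%:R * eps (- (3%:R^-1 * (harm h - harm n))) :> R.
Proof.
move=> def_k; have -> : (n = h - k)%N by lia.
rewrite (@prod_progression 3 v.+1 1) ?unit3 //; try lia.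
by rewrite mul1r.
Qed.

(** This progression is the class of 2 p modulo 3, hence runs through 2 p - 3 h' and the
    following terms. *)
Lemma progression2 k n : (k + n = h')%N ->
  (\prod_(j < k) (3 * j + (2 - v))%:R) * n`!%:R =
  (- 3%:R) ^+ k * h'`!%:R * eps (- (2%:R / 3%:R * (harm h' - harm n))) :> R.
Proof.
move=> def_k; have -> : (n = h' - k)%N by lia.
by rewrite (@prod_progression 3 (2 - v) 2) ?unit3 //; lia.
Qed.

(** Sort the factors of (p - 1)! modulo 3: the three classes give h!, h! / 0! and
    h'! / h!, and h! h'! is computed by reflection. *)
Lemma three_power_eps : 3%:R ^+ p.-1 = eps (- (2%:R / 3%:R * harm h)) :> R.
Proof.
have UW : (p.-1`!%:R : R) \is a GRing.unit by apply: unit_fact; lia.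
have Uh : (h`!%:R : R) \is a GRing.unit by apply: unit_fact; lia.
have p1 := @progression1 h 0 (addn0 _); rewrite mulr1 harm0 subr0 in p1.
have p2 := @progression2 (h + v) h ltac:(lia).
have refl := @fact_reflect h ltac:(lia).
have harm_refl := @harm_reflect h ltac:(lia) ltac:(lia).
have e2 : (p.-1 - h = h')%N by lia.
rewrite e2 in refl harm_refl.
have eqW : p.-1`!%:R * h`!%:R = (p.-1`!%:R * h`!%:R) * (3%:R ^+ p.-1 * eps (2%:R / 3%:R * harm h)) :> R.
  have {1}-> : (p.-1 = 3 * h + v)%N by lia.
  rewrite (fact3 h) -(mulrA (_ * _ * _)) p2 p1 !(exprNn 3%:R).
  set E1 := eps _; set E2 := eps _.
  transitivity ((-1) ^+ h * (-1) ^+ (h + v) * (3%:R ^+ h * 3%:R ^+ h * 3%:R ^+ (h + v)) * h`!%:R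
     * (h'`!%:R * h`!%:R) * (E1 * E2) : R); first by ring.
  rewrite refl.
  transitivity ((-1) ^+ h * (-1) ^+ (h + v) * (-1) ^+ h * (3%:R ^+ h * 3%:R ^+ h * 3%:R ^+ (h + v)) *
     (p.-1`!%:R * h`!%:R) * (eps (harm h) * (E1 * E2)) : R); first by ring.
  rewrite -!exprD -signr_odd (_ : odd _ = false); last by lia.
  rewrite mul1r (_ : (h + h + (h + v) = p.-1)%N); last by lia.
  rewrite -!epsD [_ * (_ * h`!%:R)]mulrC -!mulrA; do 3 congr (_ * _).
  apply: eps_eq12; rewrite inv3E.
  transitivity (p%:R * harm h * (12%:R - 4%:R * (12%:R / 12%:R) + 8%:R * (12%:R / 12%:R))
    - 8%:R * (p%:R * harm h') * (12%:R / 12%:R) : R); first by ring.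
  by rewrite harm_refl divrr ?unit12 //; transitivity (p%:R * harm h * 8%:R * (12%:R / 12%:R) : R); 
    [rewrite divrr ?unit12 //; ring | ring].
apply: (mulIr (eps_unit (2%:R / 3%:R * harm h))); rewrite epsN.
by apply: (mulrI Uh); apply: (mulrI UW); rewrite mulr1 [LHS]mulrA -eqW.
Qed.

(** Sorting the factors of m! modulo 3 replaces a class by h! / m!, which brings the second
    factor m! to the left-hand side.  Modulo p this relates binom(2m,m) and binom(2m,l),
    as the multiplication formula by 3 does at 1/4. *)
Lemma fact_quarter_sq : m`!%:R * m`!%:R =
  (-1) ^+ l * 3%:R ^+ m * l`!%:R * s`!%:R * eps (3%:R^-1 * (harm m - harm s)) :> R.
Proof.
have Us' : (s'`!%:R : R) \is a GRing.unit by apply: unit_fact; lia.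
have p1 := @progression1 l m ltac:(lia).
have p2 := @progression2 (l + v) s' ltac:(lia).
have refl_h := @fact_reflect h ltac:(lia).
have refl_s := @fact_reflect s ltac:(lia).
have e_h : (p.-1 - h = h')%N by lia.
have e_s : (p.-1 - s = s')%N by lia.
have harm_h := @harm_reflect h ltac:(lia) ltac:(lia).
have harm_s := @harm_reflect s ltac:(lia) ltac:(lia).
rewrite e_h in refl_h harm_h; rewrite e_s in refl_s harm_s.
set E3 := eps _.
apply: (mulIr Us').
have -> : (-1) ^+ l * 3%:R ^+ m * l`!%:R * s`!%:R * E3 * s'`!%:R =
   (-1) ^+ l * 3%:R ^+ m * l`!%:R * E3 * (s'`!%:R * s`!%:R) :> R by ring.
rewrite refl_s.
have fm : m`!%:R = 3%:R ^+ l * l`!%:R * (\prod_(j < l) (3 * j + v.+1)%:R)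
  * (\prod_(j < l + v) (3 * j + (2 - v))%:R) :> R by rewrite def_m (fact3 l).
rewrite {2}fm.
move: p1 p2; set A := \prod_(j < _) _; set B := \prod_(j < _) _ => p1 p2.
transitivity (3%:R ^+ l * l`!%:R * (A * m`!%:R) * (B * s'`!%:R) : R); first by ring.
rewrite p1 p2 !(exprNn 3%:R).
set E1 := eps _; set E2 := eps _.
transitivity ((-1) ^+ l * (-1) ^+ (l + v) * (3%:R ^+ l * 3%:R ^+ l * 3%:R ^+ (l + v)) *
     l`!%:R * (h'`!%:R * h`!%:R) * (E1 * E2) : R); first by ring.
rewrite refl_h.
transitivity ((-1) ^+ l * (-1) ^+ (l + v) * (-1) ^+ h * (3%:R ^+ l * 3%:R ^+ l * 3%:R ^+ (l + v)) *
     l`!%:R * p.-1`!%:R * (eps (harm h) * (E1 * E2)) : R); first by ring.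
transitivity ((-1) ^+ l * (-1) ^+ s * 3%:R ^+ m * l`!%:R * p.-1`!%:R * (eps (harm s) * E3) : R); last by ring.
rewrite -!exprD -signr_odd (_ : odd _ = false); last by lia.
rewrite -[(-1) ^+ (l + s)]signr_odd (_ : odd (l + s) = false); last by lia.
rewrite (_ : (l + l + (l + v) = m)%N); last by lia.
congr (_ * _); rewrite -!epsD; apply: eps_eq12; rewrite inv3E.
transitivity (p%:R * harm h * 12%:R - 4%:R * (12%:R / 12%:R) * (p%:R * harm h)
  + 4%:R * (12%:R / 12%:R) * (p%:R * harm m) - 8%:R * (12%:R / 12%:R) * (p%:R * harm h')
  + 8%:R * (12%:R / 12%:R) * (p%:R * harm s') : R); first by ring.
transitivity (p%:R * harm s * 12%:R + 4%:R * (12%:R / 12%:R) * (p%:R * harm m)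
  - 4%:R * (12%:R / 12%:R) * (p%:R * harm s) : R); last by ring.
by rewrite harm_h harm_s divrr ?unit12 //; ring.
Qed.

(** The logarithmic derivative of the preceding formula: sort the terms of H_m modulo 3. *)
Lemma harm_third : p%:R * (harm l + harm s) = p%:R * (2%:R * (harm h + harm m)).
Proof.
have e_h : (p.-1 - h = h')%N by lia.
have e_s : (p.-1 - s = s')%N by lia.
have harm_h := @harm_reflect h ltac:(lia) ltac:(lia).
have harm_s := @harm_reflect s ltac:(lia) ltac:(lia).
rewrite e_h in harm_h; rewrite e_s in harm_s.
have sumA := @sum_inv_progression 3 v.+1 1 h l unit3 ltac:(lia) ltac:(lia) ltac:(lia).
have sumB := @sum_inv_progression 3 (2 - v) 2 h' (l + v) unit3 ltac:(lia) ltac:(lia) ltac:(lia).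
have eA : (h - l = m)%N by lia.
have eB : (h' - (l + v) = s')%N by lia.
rewrite eA in sumA; rewrite eB in sumB.
have sum3 : \sum_(i < l) (3 * i.+1)%:R^-1 = 3%:R^-1 * harm l :> R.
  rewrite mulr_sumr; apply: eq_bigr => i _.
  rewrite natrM invrM ?unit3 1?mulrC //.
  by apply: unit_lt_p; have := ltn_ord i; lia.
have := big_split3 +%R (fun i => i%:R^-1 : R) l v_le1.
rewrite -def_m -/(harm m) /= sum3 => harm_mE.
have /(congr1 (fun x => 3%:R * x)) : p%:R * harm m = p%:R / 3%:R * harm l 
  - p%:R / 3%:R * (harm h - harm m) - p%:R / 3%:R * (harm h' - harm s').
  by rewrite -sumA -sumB harm_mE; ring.
have -> : 3%:R * (p%:R / 3%:R * harm l - p%:R / 3%:R * (harm h - harm m) - p%:R / 3%:R * (harm h' - harm s'))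
  = (3%:R / 3%:R) * (p%:R * harm l - p%:R * harm h + p%:R * harm m - p%:R * harm h' + p%:R * harm s') by ring.
rewrite harm_h harm_s divrr ?unit3 // mul1r => eq3.
have -> : p%:R * (harm l + harm s) = (p%:R * harm l - p%:R * harm h + p%:R * harm m - p%:R * harm h + p%:R * harm s)
  + (2%:R * (p%:R * harm h) - p%:R * harm m) by ring.
by rewrite -eq3; ring.
Qed.

(** Evaluate both progressions by prod_progression.  Reflection turns the quotient into
    binom(M,l) and fact_quarter_sq turns this into 3^m binom(M,m); the harmonic numbers
    that remain are eliminated by harm_third, and the Fermat quotient of 3, expressed by
    three_power_eps, changes 3^m into 3^(pm). *)
Lemma progression_quotient_eq (F : R) :
  F * \prod_(i < l) (12 * i + (4 * v + 1))%:R =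
    (-1) ^+ l * (\prod_(i < l) (12 * i + (4 * v + 7))%:R) * eps (- (harm M / 12%:R)) ->
  F = (-1) ^+ l * 3%:R ^+ (p * m) * ('C(M, m)%:R * eps (- ((harm M - harm m) / 2%:R))).
Proof.
have := @prod_progression 12 (4 * v + 1) 1 l l unit12 ltac:(lia) (leqnn _) ltac:(lia).
rewrite subnn mulr1 harm0 subr0 mul1r => ->.
have := @prod_progression 12 (4 * v + 7) 7 s' l unit12 ltac:(lia) ltac:(lia) ltac:(lia).
have -> : (s' - l = M)%N by lia.
set B := \prod_(j < _) _ => prodB eqF.
have Um : (m`!%:R : R) \is a GRing.unit by apply: unit_fact; lia.
have UM : (M`!%:R : R) \is a GRing.unit by apply: unit_fact; lia.
have Us : (s`!%:R : R) \is a GRing.unit by apply: unit_fact; lia.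
have Ul : ((-12%:R) ^+ l : R) \is a GRing.unit by rewrite unitrX // unitrN unit12.
have refl_M := @fact_reflect M ltac:(lia).
have refl_s := @fact_reflect s ltac:(lia).
have e_M : (p.-1 - M = M)%N by lia.
have e_s : (p.-1 - s = s')%N by lia.
have harm_s := @harm_reflect s ltac:(lia) ltac:(lia).
rewrite e_M in refl_M; rewrite e_s in refl_s harm_s.
have eqF1 : F * (l`!%:R * s`!%:R) = M`!%:R *
     eps (12%:R^-1 * (5%:R * harm s + harm l - 6%:R * harm M)).
  apply: (mulrI UM); apply: (mulrI Ul).
  set E0 := eps _.
  transitivity (F * ((-12%:R) ^+ l * l`!%:R * eps (- (12%:R^-1 * harm l)))
    * (s`!%:R * M`!%:R) * eps (12%:R^-1 * harm l) : R).
    transitivity (F * ((-12%:R) ^+ l * l`!%:R) * (s`!%:R * M`!%:R) * 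
       (eps (- (12%:R^-1 * harm l)) * eps (12%:R^-1 * harm l)) : R); last by ring.
    by rewrite epsN; ring.
  rewrite eqF.
  transitivity ((-1) ^+ l * (B * M`!%:R) * s`!%:R
     * (eps (- (harm M / 12%:R)) * eps (12%:R^-1 * harm l)) : R); first by ring.
  rewrite prodB.
  set E1 := eps _; set E2 := eps _; set E3 := eps _.
  transitivity ((-1) ^+ l * (-12%:R) ^+ l * (s'`!%:R * s`!%:R) * (E1 * (E2 * E3)) : R); first by ring.
  rewrite refl_s.
  transitivity ((-12%:R) ^+ l * (M`!%:R * M`!%:R * E0) : R); last by ring.
  rewrite refl_M.
  transitivity ((-12%:R) ^+ l * (((-1) ^+ l * (-1) ^+ s) * p.-1`!%:R * (eps (harm s) * (E1 * (E2 * E3)))) : R); first by ring.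
  rewrite -!exprD -signr_odd (_ : odd _ = false); last by lia.
  rewrite -[(-1) ^+ M]signr_odd (_ : odd M = false); last by lia.
  rewrite -(mulrA (_ * _)) -!epsD; do 2 congr (_ * _).
  apply: eps_eq12.
  transitivity (p%:R * harm s * 12%:R - 7%:R * (12%:R / 12%:R) * (p%:R * harm s')
    + 6%:R * (12%:R / 12%:R) * (p%:R * harm M) + (12%:R / 12%:R) * (p%:R * harm l) : R); first by ring.
  transitivity (p%:R * harm M * 12%:R + (12%:R / 12%:R) * (5%:R * (p%:R * harm s) + p%:R * harm l - 6%:R * (p%:R * harm M)) : R); last by ring.
  by rewrite harm_s divrr ?unit12 //; ring.
have bin_m : 'C(M, m)%:R * (m`!%:R * m`!%:R) = M`!%:R :> R.
  rewrite -!natrM -(@bin_fact M m); last by lia.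
  by rewrite (_ : (M - m = m)%N) //; lia.
have pow3 : 3%:R ^+ (p * m) = 3%:R ^+ m * eps (2%:R / 12%:R * harm h) :> R.
  have -> : (p * m = m + p.-1 * m)%N by nia.
  rewrite exprD exprM three_power_eps epsX; congr (_ * _).
  apply: eps_eq12; rewrite inv3E -mulr_natr.
  have p_m4 : 4%:R * m%:R = p%:R - 1 :> R.
    by rewrite -natrM (_ : p = (4 * m).+1)%N ?mulrSr ?addrK //; lia.
  transitivity (2%:R * (12%:R / 12%:R) * (p%:R - p%:R * p%:R) * harm h : R); last first.
    by rewrite p_sq0; ring.
  transitivity (- (2%:R * p%:R * (12%:R / 12%:R) * harm h * (4%:R * m%:R)) : R); first by ring.
  by rewrite p_m4; ring.
apply: (mulIr Um); apply: (mulIr Um); rewrite -!mulrA {1}fact_quarter_sq pow3.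
set E3 := eps _; set E2 := eps _; set E1 := eps _.
transitivity ((-1) ^+ l * 3%:R ^+ m * (F * (l`!%:R * s`!%:R)) * E3 : R); first by ring.
transitivity ((-1) ^+ l * 3%:R ^+ m * ('C(M, m)%:R * (m`!%:R * m`!%:R)) * (E2 * E1) : R); last by ring.
rewrite eqF1 bin_m [_ * (M`!%:R * _)]mulrA -[LHS]mulrA; congr (_ * _).
rewrite -!epsD; apply: eps_eq12; rewrite inv3E inv2E.
transitivity ((12%:R / 12%:R) * (p%:R * (harm l + harm s)) + (12%:R / 12%:R) *
  (4%:R * (p%:R * harm m) - 6%:R * (p%:R * harm M)) : R); first by ring.
by rewrite harm_third; ring.
Qed.

End ResidueMod12.
End FirstOrder.

(** * Binomial coefficients modulo p^2 and truncated Legendre functions *)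

Section Binomials.
Variables (R : comUnitRingType) (p : nat).
Hypothesis p_sq0 : p%:R * p%:R = 0 :> R.
Hypothesis unit_lt_p : forall k, (0 < k < p)%N -> (k%:R : R) \is a GRing.unit.
Hypotheses (p_odd : odd p) (p_gt2 : (2 < p)%N).

Let block (n : nat) : nat := (\prod_(i < n) \prod_(r < p.-1) (r + (p * i).+1))%N.

Let fact_block n : ((p * n)`! = p ^ n * n`! * block n)%N.
Proof.
elim: n => [|n IHn]; first by rewrite /block big_ord0 muln0.
have shift : forall k, ((p * n + k)`! = (p * n)`! * \prod_(r < k) (r + (p * n).+1))%N.
  elim=> [|k IHk]; first by rewrite big_ord0 addn0 muln1.
  by rewrite addnS factS IHk big_ord_recr /= mulnCA [X in (_ * X)%N]mulnC addnS addnC.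
have -> : (p * n.+1 = p * n + p.-1.+1)%N by nia.
rewrite shift IHn big_ord_recr /=.
rewrite /block big_ord_recr /= factS expnS.
have -> : (p.-1 + (p * n).+1 = p * n.+1)%N by nia.
set A := (\prod_(i < _) _)%N; set B := (\prod_(i < _) _)%N; nia.
Qed.

Let blockE n : (block n)%:R = p.-1`!%:R ^+ n :> R.
Proof.
elim: n => [|n IHn]; rewrite /block ?big_ord0 // big_ord_recr natrM IHn exprSr; congr (_ * _).
have harm_p : p%:R * harm R p.-1 = 0.
  have := harm_reflect p_sq0 unit_lt_p p_gt2 (ltnW (ltnW p_gt2)).
  by rewrite subn0 harm0 mulr0.
have := @prod_progression _ _ p_sq0 unit_lt_p 1 (p * n).+1 n.+1 p.-1 p.-1 (unitr1 R) 
  ltac:(nia) (leqnn _) ltac:(lia).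
rewrite subnn mulr1 harm0 subr0 divr1 -signr_odd (_ : odd p.-1 = false) ?mul1r; last by lia.
rewrite (_ : eps p _ = 1) ?mulr1; last first.
  by rewrite /eps mulrN mulrCA harm_p mulr0 subr0.
by rewrite natr_prod => <-; apply: eq_bigr => i _; rewrite mul1n.
Qed.

(** In (p n)! the multiples of p contribute p^n n!, and the other factors form n blocks,
    each congruent to (p - 1)! modulo p^2 because p divides H_(p-1). *)
Lemma bin_mul_p n s : (s <= n)%N -> 'C(p * n, p * s)%:R = 'C(n, s)%:R :> R.
Proof.
move=> le_sn; have UW : (p.-1`!%:R : R) \is a GRing.unit by apply: (unit_fact unit_lt_p); lia.
have eqN : ('C(p * n, p * s) * (block s * block (n - s)) = 'C(n, s) * block n)%N.
  have pos : (0 < p ^ n * (s`! * (n - s)`!))%N.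
    by rewrite !muln_gt0 !fact_gt0 expn_gt0 (ltnW (ltnW p_gt2)).
  apply/eqP; rewrite -(eqn_pmul2l pos); apply/eqP.
  have := @bin_fact (p * n) (p * s) ltac:(nia).
  rewrite -mulnBr !fact_block -{1}(bin_fact le_sn).
  have -> : (p ^ n = p ^ s * p ^ (n - s))%N by rewrite -expnD subnKC.
  move: (p ^ s)%N (p ^ (n - s))%N (block s) (block _) (block n) s`! (n - s)`! => x y z t u f g eqC.
  by rewrite [RHS](_ : _ = x * y * ('C(n, s) * (f * g)) * u)%N ?eqC //; nia.
apply: (mulIr (unitrX n UW)).
have := congr1 (fun k => k%:R : R) eqN.
by rewrite !natrM !blockE -exprD subnKC.
Qed.

(** Move from p s to p s + r one step at a time: the first step brings out the factor
    p (n - s), and in the next ones the ratio (p (n - s) - t) / (p s + t + 1) matters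
    modulo p only. *)
Lemma bin_off_p n s r : (s <= n)%N -> (r.+1 < p)%N ->
  r.+1%:R * 'C(p * n, p * s + r.+1)%:R =
  (-1) ^+ r * (p%:R * ((n - s)%:R * 'C(n, s)%:R)) :> R.
Proof.
move=> le_sn lt_rp.
have rec t : (t <= p * n - p * s)%N -> (p%:R * s%:R + t.+1%:R) * 'C(p * n, p * s + t.+1)%:R =
    (p%:R * (n - s)%:R - t%:R) * 'C(p * n, p * s + t)%:R :> R.
  move=> le_t; have := mul_bin_left (p * n) (p * s + t).
  move/(congr1 (fun k => k%:R : R)); rewrite !natrM -addnS natrD natrM => ->; congr (_ * _).
  by rewrite subnDA -mulnBr natrB ?natrM // mulnBr.
have [->|lt_sn] := eqVneq s n.
  by rewrite subnn mul0r !mulr0 bin_small ?mulr0 //; lia.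
have le_p : (p <= p * n - p * s)%N by nia.
have U t : (t.+1 < p)%N -> (p%:R * s%:R + t.+1%:R : R) \is a GRing.unit.
  by move=> lt_tp; rewrite addrC (unit_addp p_sq0) // unit_lt_p.
have rec0 t : (t.+1 < p)%N -> p%:R * 'C(p * n, p * s + t.+1)%:R = 0 :> R.
  elim: t => [|t IHt] lt_tp; apply: (mulrI (U _ lt_tp)); rewrite mulr0 mulrCA rec; try lia.
    rewrite subr0 addn0; transitivity (p%:R * p%:R * ((n - s)%:R * 'C(p * n, p * s)%:R) : R); first by ring.
    by rewrite p_sq0 mul0r.
  by rewrite mulrCA IHt ?mulr0 // ltnW.
have simp t : (t.+1 < p)%N ->
   t.+1%:R * 'C(p * n, p * s + t.+1)%:R = (p%:R * s%:R + t.+1%:R) * 'C(p * n, p * s + t.+1)%:R :> R.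
  by move=> lt_tp; rewrite mulrDl mulrAC rec0 // mul0r add0r.
elim: r lt_rp => [|r IHr] lt_rp; rewrite simp // rec; try lia.
  by rewrite subr0 addn0 bin_mul_p // mul1r mulrA.
rewrite mulrBl mulrAC rec0 ?mul0r ?sub0r; try lia.
by rewrite -mulNr mulNr IHr ?exprS ?mulN1r ?mulNr // ltnW.
Qed.

End Binomials.

Section TruncatedSum.
Variables (R : comUnitRingType) (p : nat).
Hypothesis p_sq0 : p%:R * p%:R = 0 :> R.
Hypothesis unit_lt_p : forall k, (0 < k < p)%N -> (k%:R : R) \is a GRing.unit.
Hypotheses (p_odd : odd p) (p_gt2 : (2 < p)%N).

(** This is binom(a,k) binom(-1-a,k), the coefficient of ((1 - x)/2)^k in the Legendre
    function P_a(x). *)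
Definition leg_coef (a : R) (k : nat) : R :=
  \prod_(i < k) ((i%:R - a) * (i.+1%:R + a) / i.+1%:R ^+ 2).

Definition leg_trunc (a : R) : R := \sum_(k < p) leg_coef a k / 2%:R ^+ k.

(** The symmetry P_(-1-a) = P_a of Legendre functions. *)
Lemma leg_coef_sym a k : leg_coef (- 1 - a) k = leg_coef a k.
Proof. by apply: eq_bigr => i _; congr (_ / _); rewrite -natr1; ring. Qed.

Lemma leg_coefS a k : (k.+1 < p)%N ->
  k.+1%:R ^+ 2 * leg_coef a k.+1 = leg_coef a k * ((k%:R - a) * (k.+1%:R + a)).
Proof.
move=> lt_kp; have U : (k.+1%:R ^+ 2 : R) \is a GRing.unit by rewrite unitrX // unit_lt_p.
by rewrite /leg_coef big_ord_recr /= mulrCA; congr (_ * _); rewrite mulrC divrK.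
Qed.

Lemma leg_coef_shift1 a k : (k.+1 < p)%N ->
  k.+1%:R ^+ 2 * leg_coef a k.+1 =
  - (leg_coef (a - 1) k * ((k%:R + a) * (k.+1%:R + a))).
Proof.
elim: k => [|k IHk] lt_kp.
  by rewrite leg_coefS // /leg_coef !big_ord0; ring.
have U : (k.+1%:R ^+ 2 : R) \is a GRing.unit by rewrite unitrX // unit_lt_p //; lia.
apply: (mulrI U); rewrite leg_coefS // [LHS]mulrA IHk; last by lia.
transitivity (- (k.+1%:R ^+ 2 * leg_coef (a - 1) k.+1 * ((k.+1%:R + a) * (k.+2%:R + a)))); last by ring.
rewrite leg_coefS; last by lia.
by rewrite -[k.+1%:R]natr1; ring.
Qed.

Lemma leg_coef_shift2 a k : (k.+1 < p)%N ->
  k.+1%:R ^+ 2 * leg_coef (a - 2%:R) k.+1 =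
  - (leg_coef (a - 1) k * ((k.+1%:R - a) * (k.+2%:R - a))).
Proof.
move=> lt_kp; rewrite -leg_coef_sym (_ : - 1 - (a - 2%:R) = 1 - a); last by ring.
rewrite leg_coef_shift1 // (_ : 1 - a - 1 = - 1 - (a - 1)); last by ring.
by rewrite leg_coef_sym -[k.+2%:R]natr1 -[k.+1%:R]natr1; congr (- _); ring.
Qed.

(** The partial sums of a P_a(0) + (a - 1) P_(a-2)(0) = 0, the Legendre recurrence at 0.
    The remainder is a coefficient of P_(a-1): all coefficients involved are rational
    multiples of leg_coef (a - 1) n, by the two shift lemmas. *)
Lemma leg_telescope a n : (n < p)%N ->
  \sum_(k < n.+1) (a * leg_coef a k + (a - 1) * leg_coef (a - 2%:R) k) / 2%:R ^+ k =
  (2%:R * a - 1) * leg_coef (a - 1) n / 2%:R ^+ n.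
Proof.
have U2 : (2%:R : R) \is a GRing.unit by apply: unit_lt_p; lia.
elim: n => [|n IHn] lt_np.
  by rewrite big_ord1 /leg_coef !big_ord0 expr0 !divr1; ring.
rewrite big_ord_recr /= IHn; last exact: ltnW.
have U : (n.+1%:R ^+ 2 : R) \is a GRing.unit by rewrite unitrX // unit_lt_p //; lia.
have U2n : (2%:R ^+ n.+1 : R) \is a GRing.unit by rewrite unitrX.
apply: (mulIr U2n); rewrite mulrDl !divrK //.
have -> : 2%:R ^+ n.+1 = 2%:R * 2%:R ^+ n :> R by rewrite exprS.
rewrite -!mulrA [(2%:R ^+ n)^-1 * _]mulrCA mulVr ?unitrX // mulr1.
apply: (mulrI U); rewrite !mulrDr.
rewrite [_ * (a * _)]mulrCA leg_coef_shift1 // [_ * ((a - 1) * _)]mulrCA leg_coef_shift2 //.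
rewrite [RHS]mulrCA leg_coefS //.
by rewrite -[n.+2%:R]natr1 -[n.+1%:R]natr1; ring.
Qed.

(** For a = 2j modulo p, the product in the remainder of leg_telescope has two factors
    divisible by p, namely those of index 2j - 1 and p - 2j.  The bound 4j < p makes these
    indices distinct. *)
Lemma leg_trunc_rec j x : (0 < j)%N -> (4 * j < p)%N -> let a := (2 * j)%:R + p%:R * x in
  a * leg_trunc a = - ((a - 1) * leg_trunc (a - 2%:R)).
Proof.
move=> j_gt0 lt_jp a; apply/eqP; rewrite -addr_eq0; apply/eqP.
rewrite /leg_trunc !mulr_sumr -big_split /=.
have := @leg_telescope a p.-1; rewrite (ltn_predK p_gt2) => /(_ ltac:(lia)) tel.
transitivity (\sum_(k < p) (a * leg_coef a k + (a - 1) * leg_coef (a - 2%:R) k) / 2%:R ^+ k).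
  by apply: eq_bigr => k _; ring.
rewrite tel; suff -> : leg_coef (a - 1) p.-1 = 0 by rewrite mulr0 mul0r.
have lt1 : ((2 * j).-1 < p.-1)%N by lia.
have lt2 : (p - 2 * j < p.-1)%N by lia.
rewrite /leg_coef (bigD1 (Ordinal lt1)) //= (bigD1 (Ordinal lt2)) /=; last first.
  by rewrite -val_eqE /=; apply/eqP; lia.
rewrite mulrA [X in X * _](_ : _ = 0) ?mul0r //.
have -> : (2 * j).-1%:R - (a - 1) = p%:R * - x.
  by rewrite /a -[(2 * j)%N in X in _ - (X - _)](prednK (_ : 0 < 2 * j)%N) -?natr1; [ring | lia].
have -> : (p - 2 * j).+1%:R + (a - 1) = p%:R * (1 + x).
  by rewrite /a -natr1 natrB; [ring | lia].
set A := (_ + (a - 1)); set B := (_ - (a - 1)); set C := _^-1; set D := _^-1.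
transitivity (p%:R * p%:R * (- x * (1 + x) * A * B * C * D)); first by ring.
by rewrite p_sq0 mul0r.
Qed.

Lemma sum_ord_ends (F : nat -> R) n : (0 < n)%N ->
  \sum_(i < n.+1) F i = F 0%N + \sum_(i < n.-1) F i.+1 + F n.
Proof. by case: n => // n _; rewrite big_ord_recr big_ord_recl. Qed.

Lemma sum_ord_head (F : nat -> R) n : (0 < n)%N ->
  \sum_(i < n) F i = F 0%N + \sum_(i < n.-1) F i.+1.
Proof. by case: n => // n _; rewrite big_ord_recl. Qed.

(** Modulo p^2 the fraction p / k is -(-1)^k binom(p,k), so the sum is read off from the
    expansion of (1 - 1/2)^p. *)
Lemma sum_pow2_inv :
  p%:R * (\sum_(k < p.-1) (k.+1%:R * 2%:R ^+ k.+1)^-1) = 1 - 2%:R ^- p.-1 :> R.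
Proof.
have U2 : (2%:R : R) \is a GRing.unit by apply: unit_lt_p; lia.
have binp k : (k < p.-1)%N -> p%:R * k.+1%:R^-1 = (-1) ^+ k * 'C(p, k.+1)%:R :> R.
  move=> lt_kp; have Uk : (k.+1%:R : R) \is a GRing.unit by apply: unit_lt_p; lia.
  apply: (mulIr Uk); rewrite divrK //.
  have := @bin_off_p _ _ p_sq0 unit_lt_p p_odd p_gt2 1 0 k (leq0n _) ltac:(lia).
  rewrite muln1 muln0 add0n bin0 !mulr1 -mulrA [_%:R * k.+1%:R]mulrC => ->.
  by rewrite mulrA sign_sq mul1r.
have := exprDn 1 (- 2%:R^-1) p => /(_ R).
have -> : 1 - 2%:R^-1 = 2%:R^-1 :> R.
  by apply: (mulrI U2); rewrite mulrBr mulr1 divrr // -[X in X - _]/(1 + 1) addrK.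
rewrite (sum_ord_ends (fun i => 1 ^+ (p - i) * (- 2%:R^-1) ^+ i *+ 'C(p, i))); last by lia.
rewrite bin0 expr0 mulr1 subn0 expr1n mulr1n.
rewrite subnn binn expr0 mul1r mulr1n (exprNn _ p) -signr_odd p_odd expr1 mulN1r.
rewrite mulr_sumr => eqS.
transitivity (- (\sum_(i < p.-1) (1 ^+ (p - i.+1) * (- 2%:R^-1) ^+ i.+1) *+ 'C(p, i.+1)) : R).
  rewrite -sumrN; apply: eq_bigr => i _; rewrite invrM ?unitrX //; last first.
    by apply: unit_lt_p; have := ltn_ord i; lia.
  rewrite mulrCA binp // expr1n mul1r -mulr_natr (exprNn _ i.+1) -exprVn [(-1) ^+ i.+1]exprS; ring.
have -> : \sum_(i < p.-1) (1 ^+ (p - i.+1) * (- 2%:R^-1) ^+ i.+1) *+ 'C(p, i.+1) =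
   2%:R^-1 ^+ p + 2%:R^-1 ^+ p - 1 :> R.
  by rewrite {1}eqS; ring.
rewrite -[in LHS](ltn_predK p_gt2) exprS exprVn.
transitivity (1 - (2%:R / 2%:R) * (2%:R ^- p.-1) : R); first by ring.
by rewrite divrr // mul1r.
Qed.

(** At a = p x the coefficients reduce to -p x / k for k > 0. *)
Lemma leg_trunc_base x : leg_trunc (p%:R * x) = eps p (x * (harm R p./2 / 2%:R)).
Proof.
have U2 : (2%:R : R) \is a GRing.unit by apply: unit_lt_p; lia.
have coefE k : (k < p.-1)%N -> leg_coef (p%:R * x) k.+1 = - (p%:R * x) / k.+1%:R.
  elim: k => [|k IHk] lt_kp.
    rewrite /leg_coef big_ord1 /= expr1n !divr1.
    transitivity (- (p%:R * x) - p%:R * p%:R * (x * x)); first by ring.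
    by rewrite p_sq0 mul0r subr0.
  have U1 : (k.+1%:R : R) \is a GRing.unit by apply: unit_lt_p; lia.
  have U : (k.+2%:R : R) \is a GRing.unit by apply: unit_lt_p; lia.
  apply: (mulrI (unitrX 2 U)); rewrite leg_coefS ?IHk; try lia.
  transitivity (- (p%:R * x) * k.+2%:R * (k.+1%:R / k.+1%:R) 
     + p%:R * p%:R * (x * x) * (k.+2%:R - k.+1%:R + p%:R * x) / k.+1%:R); first by ring.
  rewrite p_sq0 !mul0r addr0 divrr // mulr1.
  transitivity (- (p%:R * x) * k.+2%:R * (k.+2%:R / k.+2%:R)); last by ring.
  by rewrite divrr ?mulr1.
rewrite /leg_trunc (sum_ord_head (fun k => leg_coef (p%:R * x) k / 2%:R ^+ k)); last by lia.
rewrite {1}/leg_coef big_ord0 expr0 divr1.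
transitivity (1 - x * (p%:R * (\sum_(k < p.-1) (k.+1%:R * 2%:R ^+ k.+1)^-1))).
  rewrite !mulr_sumr -sumrN; congr (_ + _); apply: eq_bigr => i _.
  rewrite coefE // invrM ?unitrX //; first by ring.
  by apply: unit_lt_p; have := ltn_ord i; lia.
rewrite sum_pow2_inv.
have -> : 2%:R ^- p.-1 = eps p (harm R p./2 / 2%:R) :> R.
  have := @two_power_eps _ _ p_sq0 unit_lt_p p./2 ltac:(lia) ltac:(lia) => pow2.
  apply: (mulIr (unitrX p.-1 U2)); rewrite mulVr ?unitrX // pow2 mulrC.
  by rewrite (epsN p_sq0).
by rewrite /eps; ring.
Qed.

Lemma leg_trunc_chain l x : (4 * l < p)%N ->
  leg_trunc ((2 * l)%:R + p%:R * x) * \prod_(j < l) ((2 * j.+1)%:R + p%:R * x) =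
  (-1) ^+ l * (\prod_(j < l) ((2 * j).+1%:R + p%:R * x)) * eps p (x * (harm R p./2 / 2%:R)).
Proof.
elim: l => [|l IHl] lt_lp; first by rewrite !big_ord0 muln0 add0r leg_trunc_base expr0 !mulr1 mul1r.
rewrite !big_ord_recr /=; set P := \prod_(j < l) _; set a := _ + p%:R * x.
transitivity (a * leg_trunc a * P); first by ring.
rewrite leg_trunc_rec //.
have -> : a - 2%:R = (2 * l)%:R + p%:R * x by rewrite /a mulnS natrD; ring.
have -> : a - 1 = (2 * l).+1%:R + p%:R * x by rewrite /a mulnS natrD -natr1; ring.
rewrite mulNr -[in LHS]mulrA IHl; last by lia.
by rewrite exprS; ring.
Qed.

End TruncatedSum.

(** * Alternating sums of binomial coefficients *)

Section CentralBinomialSums.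
Variable R : comUnitRingType.

Lemma sum_alt_bin N n : \sum_(s < n.+1) (-1) ^+ s * 'C(N.+1, s)%:R = (-1) ^+ n * 'C(N, n)%:R :> R.
Proof.
elim: n => [|n IHn]; first by rewrite big_ord1 !bin0.
by rewrite big_ord_recr /= IHn binS natrD exprS; ring.
Qed.

(** Applying Pascal's rule twice writes the summand as N + 1 times the difference of two
    binomials of 2N at distance two, and the alternating sum telescopes. *)
Lemma sum_alt_centered_bin N n :
  \sum_(s < n.+1) (-1) ^+ s * ((N.+1)%:R - s%:R) * 'C(2 * N.+1, s)%:R =
  (-1) ^+ n * N.+1%:R * ('C(2 * N, n)%:R - (if n is n'.+1 then 'C(2 * N, n')%:R else 0)) :> R.
Proof.
have -> : (2 * N.+1 = (2 * N).+2)%N by lia.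
have key k : ((N.+1)%:R - k.+1%:R) * 'C((2 * N).+2, k.+1)%:R =
     N.+1%:R * ('C(2 * N, k.+1)%:R - (if k is k'.+1 then 'C(2 * N, k')%:R else 0)) :> R.
  have e1 := mul_bin_diag (2 * N).+2 k.
  have := congr1 (fun k => k%:R : R) e1; rewrite !natrM.
  set A : R := 'C((2 * N).+2, k.+1)%:R => eA.
  have e2 : A = 'C(2 * N, k.+1)%:R + 'C(2 * N, k)%:R + 
     ('C(2 * N, k)%:R + (if k is k'.+1 then 'C(2 * N, k')%:R else 0)).
    rewrite /A !binS !natrD; case: (k) => [|k']; last by rewrite binS natrD.
    by rewrite !bin0 addr0.
  have e3 : 'C((2 * N).+1, k)%:R = 'C(2 * N, k)%:R + (if k is k'.+1 then 'C(2 * N, k')%:R else 0) :> R.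
    by case: (k) => [|k']; rewrite ?bin0 ?addr0 // binS natrD.
  rewrite mulrBl -eA e3 e2 -[(2 * N).+2%:R]natr1 -[(2 * N).+1%:R]natr1 natrM -[N.+1%:R]natr1.
  by move: (match k with 0%N => _ | _ => _ end) => c; ring.
elim: n => [|n IHn]; first by rewrite big_ord1 /= !bin0 !subr0 !expr0; ring.
rewrite big_ord_recr /= IHn -[_ ^+ n.+1 * _ * _]mulrA key exprS; ring.
Qed.

(** Induction on n, from (n + 1)^2 = (n + 1 - s)^2 + s (2n + 2 - s): the first part leads to
    sum_alt_centered_bin, in the second one the binomial of 2n + 2 becomes one of 2n. *)
Lemma sum_alt_bin_inv n : (forall k, (0 < k <= 2 * n)%N -> (k%:R : R) \is a GRing.unit) ->
  \sum_(s < n) (-1) ^+ s * 'C(2 * n, s)%:R / (n - s)%:R =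
  - ((-1) ^+ n * 'C(2 * n, n)%:R * (harm R (2 * n) - harm R n)) :> R.
Proof.
elim: n => [|n IHn] unitR; first by rewrite big_ord0 !harm0 subrr mulr0 oppr0.
have {}IHn := IHn (fun k lek => unitR k ltac:(lia)).
have UN : (n.+1%:R : R) \is a GRing.unit by apply: unitR; lia.
have U1 : ((2 * n).+1%:R : R) \is a GRing.unit by apply: unitR; lia.
have U2 : ((2 * n).+2%:R : R) \is a GRing.unit by apply: unitR; lia.
have catalan : n.+1%:R * ('C(2 * n, n)%:R - (if n is n'.+1 then 'C(2 * n, n')%:R else 0)) = 'C(2 * n, n)%:R :> R.
  case: (n) => [|k]; first by rewrite !bin0 subr0 mulr1.
  have := congr1 (fun k => k%:R : R) (mul_bin_left (2 * k.+1) k).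
  rewrite !natrM (_ : (2 * k.+1 - k = k.+2)%N); last by lia.
  by rewrite mulrBr => <-; rewrite -[k.+2%:R]natr1; ring.
have binE : n.+1%:R * 'C(2 * n.+1, n.+1)%:R = 2%:R * (2 * n).+1%:R * 'C(2 * n, n)%:R :> R.
  have e1 := mul_bin_diag (2 * n).+2 n.
  have e2 := mul_bin_down (2 * n).+1 n.
  have e3 : (2 * n.+1 = (2 * n).+2)%N by lia.
  have e4 : ((2 * n).+1 - n = n.+1)%N by lia.
  rewrite e3 -!natrM; congr _%:R; rewrite -e1 /=; rewrite e4 /= in e2.
  by rewrite -mulnA e2 mulnA; congr (_ * _)%N; lia.
have step (s : nat) : (s.+1 < n.+1)%N -> n.+1%:R ^+ 2 * 'C(2 * n.+1, s.+1)%:R / (n.+1 - s.+1)%:R =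
   (n.+1%:R - s.+1%:R) * 'C(2 * n.+1, s.+1)%:R +
   (2 * n).+2%:R * (2 * n).+1%:R * ('C(2 * n, s)%:R / (n - s)%:R) :> R.
  move=> lt_sn; rewrite subSS; have U : ((n - s)%:R : R) \is a GRing.unit by apply: unitR; lia.
  apply: (mulIr U); rewrite divrK // mulrDl !mulrA divrK // -natrB ?(ltnW lt_sn) // subSS.
  have -> : (2 * n.+1 = (2 * n).+2)%N by lia.
  have e1 := mul_bin_diag (2 * n).+2 s.
  have e2 := mul_bin_down (2 * n).+1 s; rewrite /= in e2.
  rewrite -!natrM -natrX -natrM -natrD; congr _%:R.
  have : ((2 * n).+2 * (2 * n).+1 * 'C(2 * n, s) = ((2 * n).+1 - s) * (s.+1 * 'C((2 * n).+2, s.+1)))%N.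
    by rewrite -e1 /= -mulnA e2 mulnCA.
  move=> ->; move: ('C(_, _)) => C; nia.

have sum2 : \sum_(s < n.+1) (-1) ^+ s * (n.+1%:R ^+ 2 * 'C(2 * n.+1, s)%:R / (n.+1 - s)%:R)
   = \sum_(s < n.+1) (-1) ^+ s * (n.+1%:R - s%:R) * 'C(2 * n.+1, s)%:R 
     - (2 * n).+2%:R * (2 * n).+1%:R * \sum_(s < n) (-1) ^+ s * 'C(2 * n, s)%:R / (n - s)%:R :> R.
  rewrite 2!big_ord_recl mulr_sumr -addrA -sumrB /= !bin0 expr2 mulr1 mul1r mulrK // subr0 mul1r mulr1.
  congr (_ + _); apply: eq_bigr => i _; rewrite /bump /= add1n step ?ltnS //.
  by rewrite exprS; ring.
have -> : \sum_(s < n.+1) (-1) ^+ s * 'C(2 * n.+1, s)%:R / (n.+1 - s)%:R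
  = n.+1%:R ^- 2 * \sum_(s < n.+1) (-1) ^+ s * (n.+1%:R ^+ 2 * 'C(2 * n.+1, s)%:R / (n.+1 - s)%:R) :> R.
  rewrite mulr_sumr; apply: eq_bigr => s _.
  transitivity (n.+1%:R ^- 2 * n.+1%:R ^+ 2 * ((-1) ^+ s * 'C(2 * n.+1, s)%:R / (n.+1 - s)%:R) : R); last by ring.
  by rewrite mulVr ?unitrX // mul1r.
rewrite sum2 sum_alt_centered_bin -mulrA catalan IHn.
apply: (mulrI (unitrX 2 UN)); rewrite mulrA divrr ?unitrX // mul1r.
have harm2 : harm R (2 * n.+1) = harm R (2 * n) + (2 * n).+1%:R^-1 + (2 * n).+2%:R^-1.
  by rewrite (_ : (2 * n.+1 = (2 * n).+2)%N) ?harmS //; lia.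
rewrite harm2 harmS.
transitivity ((-1) ^+ n * (n.+1%:R * (n.+1%:R * 'C(2 * n.+1, n.+1)%:R)) *
  (harm R (2 * n) + (2 * n).+1%:R^-1 + (2 * n).+2%:R^-1 - (harm R n + n.+1%:R^-1)) : R); last first.
  by rewrite [(-1) ^+ n.+1]exprS; ring.
rewrite binE.
have d2 : (2 * n).+2%:R = 2%:R * n.+1%:R :> R by rewrite -natrM; congr _%:R; lia.
have iN : n.+1%:R^-1 = 2%:R / (2 * n).+2%:R :> R.
  by apply: (mulrI UN); rewrite divrr // mulrA [_ * 2%:R]mulrC -d2 divrr.
have d1 : (2 * n).+1%:R = (2 * n).+2%:R - 1 :> R by rewrite -[(2 * n).+2%:R]natr1 addrK.
transitivity ((-1) ^+ n * 'C(2 * n, n)%:R * ((2 * n).+2%:R * (2 * n).+1%:R * (harm R (2 * n) - harm R n)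
   + ((2 * n).+1%:R / (2 * n).+1%:R) * (2 * n).+2%:R
   - ((2 * n).+2%:R / (2 * n).+2%:R) * (2 * n).+1%:R) : R).
  by rewrite !divrr // -[(2 * n).+2%:R]natr1; ring.
by rewrite iN d2; ring.
Qed.

End CentralBinomialSums.

(** * Teichmueller representatives and the p-adic value of the Jacobi sum *)

Section Teichmuller.
Variables (R : comUnitRingType) (p : nat).
Hypothesis p_sq0 : p%:R * p%:R = 0 :> R.
Hypothesis unit_lt_p : forall k, (0 < k < p)%N -> (k%:R : R) \is a GRing.unit.
Hypotheses (p_prime : prime p) (p_odd : odd p) (p_gt2 : (2 < p)%N).

(** The p-th power of an integer modulo p^2 depends on its residue modulo p only; this
    defines the Teichmueller lift in Z/p^2. *)
Definition teich (x : 'F_p) : R := (x : nat)%:R ^+ p.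

Lemma exp_addp n x y : (x + p%:R * y) ^+ n.+1 = x ^+ n.+1 + n.+1%:R * (p%:R * (x ^+ n * y)) :> R.
Proof.
elim: n => [|n IHn]; first by rewrite !expr1 expr0 !mul1r.
rewrite exprS IHn [x ^+ n.+2]exprS [x ^+ n.+1]exprS -[n.+2%:R]natr1.
transitivity (x * (x * x ^+ n) + (n.+1%:R + 1) * (p%:R * (x * x ^+ n * y)) +
   p%:R * p%:R * (n.+1%:R * x ^+ n * y * y)); first by ring.
by rewrite p_sq0 mul0r addr0.
Qed.

Lemma exp_p_addp x y : (x + p%:R * y) ^+ p = x ^+ p :> R.
Proof.
rewrite -(ltn_predK p_gt2) -{2}(ltn_predK p_gt2).
have := exp_addp p.-1 x y; rewrite (ltn_predK p_gt2) => ->.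
by rewrite mulrA p_sq0 mul0r addr0.
Qed.

Lemma Fp_lt (x : 'F_p) : (x < p)%N.
Proof. by rewrite -{2}(Fp_cast p_prime). Qed.

Lemma teich_nat k : teich k%:R = k%:R ^+ p.
Proof.
rewrite /teich val_Fp_nat // {2}(divn_eq k p) addnC natrD mulnC natrM exp_p_addp //.
Qed.

Lemma teich0 : teich 0 = 0.
Proof. by rewrite /teich expr0n; case: (p) p_gt2. Qed.

Lemma teich1 : teich 1 = 1.
Proof. by rewrite (teich_nat 1) expr1n. Qed.

Lemma teichM x y : teich (x * y) = teich x * teich y.
Proof. by rewrite -{1}[x]natr_Zp -{1}[y]natr_Zp -natrM teich_nat natrM exprMn. Qed.

Lemma teichX x n : teich (x ^+ n) = teich x ^+ n.
Proof. by elim: n => [|n IHn]; rewrite ?teich1 // !exprS teichM IHn. Qed.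

Lemma Fp_oppE (x : 'F_p) : - x = (p - x)%:R.
Proof.
have eq0 : x + (p - x)%:R = 0.
  by rewrite -{1}(natr_Zp x) -natrD subnKC ?pchar_Fp_0 // ltnW // Fp_lt.
by apply: (addrI x); rewrite eq0 subrr.
Qed.

Lemma teichN x : teich (- x) = - teich x.
Proof.
rewrite (etrans (congr1 teich (Fp_oppE x)) (teich_nat _)) (natrB R (ltnW (Fp_lt x))) addrC -[p%:R in LHS]mulr1 exp_p_addp.
by rewrite exprNn -signr_odd p_odd expr1 mulN1r.
Qed.

Lemma fermat_lift k : exists z, (k%:R : R) ^+ p = k%:R + p%:R * z.
Proof.
have eq_mod : k ^ p = k %[mod p] by apply: fermat_little.
have [le_kp|] := leqP k (k ^ p).
  have /dvdnP[q def_q] : (p %| k ^ p - k)%N by rewrite -eqn_mod_dvd // eq_mod.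
  exists q%:R; rewrite -natrX -natrM -natrD mulnC -def_q; congr _%:R; lia.
case: k {eq_mod} => [|k]; first by rewrite ltn0.
by rewrite ltnNge -{1}(expn1 k.+1) leq_pexp2l //; lia.
Qed.

Lemma teich_1sub x : teich (1 - x) = (1 - teich x) ^+ p.
Proof.
have [z teichE] := fermat_lift x.
rewrite /(teich x) teichE.
have -> : 1 - x = (1 + (p - x))%:R.
  by rewrite natrD -(Fp_oppE x).
rewrite (teich_nat (1 + (p - x))) natrD (natrB R (ltnW (Fp_lt x))).
transitivity ((1 - (x : nat)%:R + p%:R * 1) ^+ p : R); first by congr (_ ^+ _); ring.
rewrite exp_p_addp; transitivity ((1 - (x : nat)%:R + p%:R * - z) ^+ p : R); last by congr (_ ^+ _); ring.
by rewrite exp_p_addp.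
Qed.

(** The lift is the identity modulo p, so a lift other than 1 is not even congruent to 1
    modulo p. *)
Lemma teich_sub1_unit y : y != 1 -> teich y - 1 \is a GRing.unit.
Proof.
move=> y_neq1; have [z yE] := fermat_lift y; rewrite /teich yE addrAC.
apply: (unit_addp p_sq0); case: (posnP (y : nat)) => [-> | y_gt0].
  by rewrite sub0r unitrN1.
rewrite -(prednK y_gt0) -natr1 addrK; apply: unit_lt_p.
have := Fp_lt y; have : (y : nat) != 1%N by apply: contraNneq y_neq1 => y1; rewrite -[y]natr_Zp y1.
by lia.
Qed.

Lemma Fp_exp_pred (y : 'F_p) : y != 0 -> y ^+ p.-1 = 1.
Proof.
move=> y0; have expp : y ^+ p = y by have := expf_card y; rewrite card_Fp.
by apply: (mulfI y0); rewrite mulr1 -exprS (ltn_predK p_gt2).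
Qed.

Lemma exists_exp_neq1 N : ~~ (p.-1 %| N)%N -> exists2 y : 'F_p, y != 0 & y ^+ N != 1.
Proof.
move=> ndvd; apply/exists_inP; apply: contraT; rewrite negb_exists_in => /forall_inP all1.
set r := (N %% p.-1)%N.
have r_gt0 : (0 < r)%N by rewrite lt0n.
have lt_r : (r < p.-1)%N by rewrite ltn_mod; lia.
have root_r (y : 'F_p) : y != 0 -> y ^+ r = 1.
  move=> y0; have := all1 y y0; rewrite negbK => /eqP.
  by rewrite {1}(divn_eq N p.-1) exprD mulnC exprM Fp_exp_pred // expr1n mul1r.
have := @max_unity_roots _ r (enum [pred y : 'F_p | y != 0]) r_gt0.
rewrite enum_uniq -cardE => /(_ _ isT).
have -> : #|[pred y : 'F_p | y != 0]| = p.-1 by have := cardC1 (0 : 'F_p); rewrite (card_Fp p_prime) => <-; apply: eq_card.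
have -> : all r.-unity_root (enum [pred y : 'F_p | y != 0]).
  by apply/allP => y; rewrite mem_enum inE => y0; apply/unity_rootP; apply: root_r.
by move=> /(_ isT); lia.
Qed.

Lemma sum_teich_pow N : (0 < N)%N ->
  \sum_(x : 'F_p) teich x ^+ N = if (p.-1 %| N)%N then p%:R - 1 else 0 :> R.
Proof.
move=> N_gt0; case: ifPn => [/dvdnP[q def_N] | /exists_exp_neq1[y y0 yN]]; last first.
  have U : teich (y ^+ N) - 1 \is a GRing.unit by apply: teich_sub1_unit.
  apply: (mulrI U); rewrite mulr0 mulrBl mul1r; apply/eqP; rewrite subr_eq0; apply/eqP.
  rewrite [RHS](reindex_inj (mulfI y0)) mulr_sumr; apply: eq_bigr => x _.
  by rewrite teichM exprMn teichX.
rewrite (bigD1 (0 : 'F_p)) //= teich0 expr0n (gtn_eqF N_gt0) add0r.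
rewrite (eq_bigr (fun _ => 1)) => [|x x0]; last first.
  by rewrite def_N mulnC exprM -teichX Fp_exp_pred // teich1 expr1n.
rewrite sumr_const (_ : #|_| = p.-1); first by rewrite -subn1 natrB // ltnW // ltnW.
by have := cardC1 (0 : 'F_p); rewrite card_Fp.
Qed.

(** Expand (1 - T)^(2pm) and sum over T: only the exponents k = m + 4ms remain, and they
    are symmetric about pm.  The middle one gives binom(2m,m); writing k = ps + (m - s), the
    others are multiples of p given by bin_off_p, and sum_alt_bin_inv adds them up. *)
Lemma jacobi_sum_teich m : p = (4 * m).+1 ->
  \sum_(x : 'F_p) teich x ^+ (3 * m) * (1 - teich x) ^+ (p * (2 * m)) =
  - ((-1) ^+ m * ('C(2 * m, m)%:R * eps p (- ((harm R (2 * m) - harm R m) / 2%:R)))).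
Proof.
move=> def_p; have m_gt0 : (0 < m)%N by lia.
have U2 : (2%:R : R) \is a GRing.unit by apply: unit_lt_p; lia.
set M := (2 * m)%N; set n := (p * M)%N.
pose c k : R := (-1) ^+ k * 'C(n, k)%:R.
have binomE t : (1 - t) ^+ n = \sum_(k < n.+1) c k * t ^+ k.
  rewrite exprDn; apply: eq_bigr => k _.
  by rewrite expr1n mul1r exprNn -mulr_natr /c; ring.
pose e s := (m + 4 * m * s)%N.
have -> : \sum_(x : 'F_p) teich x ^+ (3 * m) * (1 - teich x) ^+ n =
   (p%:R - 1) * \sum_(s < M.+1) c (e s).
  transitivity (\sum_(k < n.+1) c k * \sum_(x : 'F_p) teich x ^+ (3 * m + k)).
    under eq_bigr do rewrite binomE mulr_sumr.
    rewrite exchange_big /=; apply: eq_bigr => k _; rewrite mulr_sumr.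
    by apply: eq_bigr => x _; rewrite exprD mulrCA.
  under eq_bigr => k _.
    rewrite sum_teich_pow; last by lia.
    over.
  rewrite (eq_bigr (fun k : 'I_n.+1 => if (p.-1 %| 3 * m + k)%N then (p%:R - 1) * c k else 0)); last first.
    by move=> k _; case: ifP; rewrite ?mulr0 // mulrC.
  rewrite -big_mkcond mulr_sumr /=.
  have e_lt (s : 'I_M.+1) : (e s < n.+1)%N by have := ltn_ord s; rewrite /e /n /M; nia.
  have def_p1 : (p.-1 = 4 * m)%N by lia.
  rewrite (reindex_onto (fun s : 'I_M.+1 => Ordinal (e_lt s)) (fun k : 'I_n.+1 => inord ((k - m) %/ (4 * m)))) /=; last first.
    move=> k /dvdnP[q def_k]; apply: val_inj; rewrite /= /e; rewrite def_p1 in def_k.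
    have lt_kn := ltn_ord k.
    have q_gt0 : (0 < q)%N by rewrite lt0n; apply/eqP => q0; move: def_k; rewrite q0; lia.
    have -> : (k - m = q.-1 * (4 * m))%N by nia.
    rewrite mulnK ?muln_gt0 // inordK; first by nia.
    have lt_q : (q * (4 * m) < (M + 2) * (4 * m))%N.
      by rewrite -def_k; move: lt_kn; rewrite /n /M; nia.
    by rewrite ltn_pmul2r ?muln_gt0 // in lt_q; lia.
  apply: eq_bigl => s; rewrite /e addKn mulKn ?muln_gt0 // inord_val eqxx andbT.
  apply/dvdnP; exists s.+1; rewrite def_p1; nia.
have sum_halves : \sum_(s < M.+1) c (e s) = c (e m) + 2%:R * \sum_(s < m) c (e s).
  have c_sym (s : nat) : (s <= M)%N -> c (e (M - s)%N) = c (e s).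
    move=> le_sM; have -> : e (M - s)%N = (n - e s)%N by rewrite /e /n /M in le_sM *; nia.
    have le_en : (e s <= n)%N by rewrite /e /n /M in le_sM *; nia.
    rewrite /c bin_sub //; congr (_ * _).
    by rewrite -signr_odd -[RHS]signr_odd; congr (_ ^+ _); rewrite /n; congr nat_of_bool; lia.
  have -> : M.+1 = (m.+1 + m)%N by lia.
  rewrite big_split_ord big_ord_recr /= [_ + c (e m)]addrC -addrA mulr_natl mulr2n; congr (_ + (_ + _)).
  rewrite (reindex_inj rev_ord_inj) /=; apply: eq_bigr => s _; have lt_sm := ltn_ord s.
  by rewrite -c_sym; [congr (c (e _)) | ]; lia.
rewrite sum_halves.
have -> : c (e m) = (-1) ^+ m * 'C(M, m)%:R.
  rewrite /c (_ : e m = (p * m)%N); last by rewrite /e; nia.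
  rewrite bin_mul_p //; try lia; congr (_ * _).
  by rewrite -signr_odd -[RHS]signr_odd; congr (_ ^+ _); congr nat_of_bool; lia.
have cE (s : 'I_m) : c (e s) = - (p%:R *
    ((-1) ^+ s * 'C(M, s)%:R + m%:R * ((-1) ^+ s * 'C(M, s)%:R / (m - s)%:R))).
  have lt_sm := ltn_ord s; have [r def_r] : exists r, (m = s + r.+1)%N by exists (m - s).-1; lia.
  have Ur : (r.+1%:R : R) \is a GRing.unit by apply: unit_lt_p; lia.
  have -> : (m - s = r.+1)%N by lia.
  rewrite /c; have -> : (e s = p * s + r.+1)%N by rewrite /e; nia.
  have binE := bin_off_p p_sq0 unit_lt_p p_odd p_gt2 (ltac:(rewrite /M; lia) : (s <= M)%N) (ltac:(lia) : (r.+1 < p)%N).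
  rewrite -/n in binE.
  apply: (mulIr Ur); rewrite -[LHS]mulrA ['C(n, _)%:R * _]mulrC binE [LHS]mulrA -exprD.
  have -> : (M - s)%:R = m%:R + r.+1%:R :> R by rewrite -natrD; congr _%:R; lia.
  have -> : (-1) ^+ (p * s + r.+1 + r) = - (-1) ^+ s :> R.
    by rewrite -[RHS]mulN1r -exprS -signr_odd -[RHS]signr_odd; congr (_ ^+ _); congr nat_of_bool; lia.
  transitivity (- (p%:R * ((-1) ^+ s * 'C(M, s)%:R * r.+1%:R
     + m%:R * ((-1) ^+ s * 'C(M, s)%:R * (r.+1%:R / r.+1%:R)))) : R); last by ring.
  by rewrite divrr //; ring.
rewrite (eq_bigr _ (fun s _ => cE s)) sumrN -mulr_sumr big_split /= -mulr_sumr.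
rewrite sum_alt_bin_inv; last by move=> k lek; apply: unit_lt_p; lia.
have half : 2%:R * \sum_(s < m) (-1) ^+ s * 'C(M, s)%:R = - ((-1) ^+ m * 'C(M, m)%:R) :> R.
  have [m' def_m] : exists m', m = m'.+1 by exists m.-1; lia.
  rewrite /M def_m (_ : 2 * m'.+1 = (2 * m' + 1).+1)%N ?sum_alt_bin; last by lia.
  have sym : 'C(2 * m' + 1, m'.+1) = 'C(2 * m' + 1, m').
    by rewrite -bin_sub; [congr 'C(_, _) | ]; lia.
  by rewrite binS sym natrD exprS; ring.
have m4 : m%:R * 4%:R = p%:R - 1 :> R by rewrite -natrM def_p -natr1 addrK mulnC.
(* 2m is -1/2 modulo p *)
have eps_val : eps p (- ((harm R M - harm R m) / 2%:R)) = 1 + 2%:R * p%:R * m%:R * (harm R M - harm R m).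
  rewrite /eps; congr (_ + _); apply: (mulrI U2).
  transitivity (- (p%:R * (harm R M - harm R m) * (2%:R / 2%:R)) : R); first by ring.
  transitivity (p%:R * (m%:R * 4%:R) * (harm R M - harm R m) : R); last by ring.
  rewrite m4 divrr //.
  transitivity (p%:R * p%:R * (harm R M - harm R m) - p%:R * (harm R M - harm R m)); last by ring.
  by rewrite p_sq0; ring.
set X := harm R M - harm R m in eps_val *; set C := 'C(M, m)%:R; set S := \sum_(s < m) _ in half *.
rewrite eps_val.
transitivity ((p%:R - 1) * ((-1) ^+ m * C - p%:R * (2%:R * S)
   + 2%:R * p%:R * m%:R * ((-1) ^+ m * C * X)) : R); first by ring.
rewrite half.
transitivity (- ((-1) ^+ m * (C * (1 + 2%:R * p%:R * m%:R * X)))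
  + p%:R * p%:R * ((-1) ^+ m * C + 2%:R * m%:R * ((-1) ^+ m * C * X)) : R); first by rewrite /C; ring.
by rewrite p_sq0 mul0r addr0.
Qed.

End Teichmuller.

(** * Gaussian integers *)

Record gint := Gint { gre : int; gim : int }.

Lemma gint_eqP z w : gre z = gre w -> gim z = gim w -> z = w.
Proof. by case: z w => [a b] [c d] /= -> ->. Qed.

Definition pair_of_gint z := (gre z, gim z).
Definition gint_of_pair u := Gint u.1 u.2.
Lemma pair_of_gintK : cancel pair_of_gint gint_of_pair.
Proof. by case. Qed.
HB.instance Definition _ := Choice.copy gint (can_type pair_of_gintK).

Definition gzero := Gint 0 0.
Definition gone := Gint 1 0.
Definition gopp z := Gint (- gre z) (- gim z).
Definition gadd z w := Gint (gre z + gre w) (gim z + gim w).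
Definition gmul z w := Gint (gre z * gre w - gim z * gim w) (gre z * gim w + gim z * gre w).

Lemma gaddA : associative gadd.
Proof. by move=> x y z; apply: gint_eqP; rewrite /= addrA. Qed.
Lemma gaddC : commutative gadd.
Proof. by move=> x y; apply: gint_eqP; rewrite /= addrC. Qed.
Lemma gadd0 : left_id gzero gadd.
Proof. by move=> x; apply: gint_eqP; rewrite /= add0r. Qed.
Lemma gaddN : left_inverse gzero gopp gadd.
Proof. by move=> x; apply: gint_eqP; rewrite /= addNr. Qed.
HB.instance Definition _ := GRing.isZmodule.Build gint gaddA gaddC gadd0 gaddN.

Lemma gmulA : associative gmul.
Proof. by move=> x y z; apply: gint_eqP => /=; ring. Qed.
Lemma gmulC : commutative gmul.
Proof. by move=> x y; apply: gint_eqP => /=; ring. Qed.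
Lemma gmul1 : left_id gone gmul.
Proof. by move=> x; apply: gint_eqP => /=; ring. Qed.
Lemma gmulDl : left_distributive gmul gadd.
Proof. by move=> x y z; apply: gint_eqP => /=; ring. Qed.
Lemma gone_neq0 : gone != 0 :> gint.
Proof. by []. Qed.
HB.instance Definition _ := GRing.Zmodule_isComNzRing.Build gint gmulA gmulC gmul1 gmulDl gone_neq0.

Definition gi : gint := Gint 0 1.
Definition gconj z := Gint (gre z) (- gim z).

Lemma greD z w : gre (z + w) = gre z + gre w. Proof. by []. Qed.
Lemma gimD z w : gim (z + w) = gim z + gim w. Proof. by []. Qed.
Lemma greN z : gre (- z) = - gre z. Proof. by []. Qed.
Lemma gimN z : gim (- z) = - gim z. Proof. by []. Qed.
Lemma greM z w : gre (z * w) = gre z * gre w - gim z * gim w. Proof. by []. Qed.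
Lemma gimM z w : gim (z * w) = gre z * gim w + gim z * gre w. Proof. by []. Qed.
Lemma gre_nat n : gre n%:R = n%:R.
Proof. by elim: n => // n IHn; rewrite -!natr1 greD IHn. Qed.
Lemma gim_nat n : gim n%:R = 0.
Proof. by elim: n => // n IHn; rewrite -!natr1 gimD IHn. Qed.

Lemma gconjD : {morph gconj : z w / z + w}.
Proof. by move=> z w; apply: gint_eqP => //=; rewrite opprD. Qed.
Lemma gconjM : {morph gconj : z w / z * w}.
Proof. by move=> z w; apply: gint_eqP => /=; ring. Qed.
Lemma gconj0 : gconj 0 = 0. Proof. by []. Qed.

Lemma gint_double_eq0 (z : gint) : z = - z -> z = 0.
Proof. by case: z => a b [? ?]; apply: gint_eqP => /=; lia. Qed.

Section Evaluation.
Variables (R : comNzRingType) (iota : R).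
Hypothesis iota_sq : iota * iota = -1.
Definition gev (z : gint) : R := (gre z)%:~R + (gim z)%:~R * iota.

Lemma gev0 : gev 0 = 0. Proof. by rewrite /gev mul0r addr0. Qed.
Lemma gev1 : gev 1 = 1. Proof. by rewrite /gev mul0r addr0. Qed.
Lemma gev_i : gev gi = iota. Proof. by rewrite /gev mul1r add0r. Qed.
Lemma gevN z : gev (- z) = - gev z.
Proof. by rewrite /gev greN gimN !rmorphN /=; ring. Qed.
Lemma gevD : {morph gev : z w / z + w}.
Proof. by move=> z w; rewrite /gev greD gimD !rmorphD /=; ring. Qed.
Lemma gevM : {morph gev : z w / z * w}.
Proof.
move=> z w; rewrite /gev greM gimM rmorphB rmorphD !rmorphM /=.
set a := (gre z)%:~R; set b := (gim z)%:~R; set c := (gre w)%:~R; set d := (gim w)%:~R.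
transitivity (a * c + b * d * (-1) + (a * d + b * c) * iota); first by ring.
by rewrite -iota_sq; ring.
Qed.
End Evaluation.

(** The values of the quartic character: the units of Z[i], and 0. *)
Definition gunits0 : seq gint := [:: 0; 1; -1; gi; - gi].

Lemma gunits0M u v : u \in gunits0 -> v \in gunits0 -> u * v \in gunits0.
Proof.
have : all (fun u => all (fun v => u * v \in gunits0) gunits0) gunits0 by [].
by move=> /allP H /H /allP; apply.
Qed.

Lemma gunits0_conj u : u \in gunits0 -> u != 0 -> gconj u * u = 1.
Proof.
have : all (fun u => (u != 0) ==> (gconj u * u == 1)) gunits0 by [].
by move=> /allP H /H /implyP uP /uP /eqP.
Qed.

(** * Jacobi sums over a finite field *)

(** The character takes its values in an arbitrary ring; chi' is its inverse, to be
    specialized to the complex conjugate. *)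
Section JacobiSums.
Variables (F : finFieldType) (G : comNzRingType) (chi chi' psi : F -> G).
Hypotheses (chiM : {morph chi : x y / x * y}) (chi0 : chi 0 = 0) (chi1 : chi 1 = 1).
Hypothesis chiV : forall x, x != 0 -> chi' x * chi x = 1.
Hypothesis chi'0 : chi' 0 = 0.
Hypothesis psiE : forall x, psi x = chi x ^+ 2.
Hypothesis psi_sq : forall x, x != 0 -> psi x * psi x = 1.
Hypotheses (sum_chi : \sum_x chi x = 0) (sum_psi : \sum_x psi x = 0).
Hypothesis sum_chi_psi : \sum_x chi x * psi x = 0.

Let psiM x y : psi (x * y) = psi x * psi y.
Proof. by rewrite !psiE chiM exprMn. Qed.
Let psi0 : psi 0 = 0. Proof. by rewrite psiE chi0 expr0n. Qed.
Let psi1 : psi 1 = 1. Proof. by rewrite psiE chi1 expr1n. Qed.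

Lemma one_sub_inj : injective (fun x : F => 1 - x).
Proof. by move=> x y /addrI /oppr_inj. Qed.

(** For z nonzero the summand is psi (1 + c / z), and z |-> c / z permutes the nonzero
    elements. *)
Lemma sum_psi_shift c : c != 0 -> \sum_z psi (z + c) * psi z = -1.
Proof.
move=> c0; rewrite (bigD1 (0 : F)) //= psi0 mulr0 add0r.
transitivity (\sum_(z : F | z != 0) psi (1 + c * z^-1)).
  apply: eq_bigr => z z0; have -> : z + c = z * (1 + c * z^-1).
    by rewrite mulrDr mulr1 mulrCA divff // mulr1.
  by rewrite psiM mulrAC psi_sq // mul1r.
rewrite (reindex_onto (fun y : F => c / y) (fun z => c / z)) /=; last first.
  by move=> z z0; rewrite invf_div mulrCA divff // mulr1.
transitivity (\sum_(y : F | y != 0) psi (1 + y)).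
  apply: eq_big => [y|y y0].
    rewrite mulf_eq0 invr_eq0 (negbTE c0) /=; case: eqP => //= /eqP y0.
    by rewrite invf_div mulrCA divff // mulr1 eqxx.
  have {}y0 : y != 0 by move: y0; rewrite mulf_eq0 invr_eq0 negb_or => /andP[/andP[]].
  by congr (psi (_ + _)); rewrite invf_div mulrCA divff // mulr1.
have := sum_psi; rewrite (reindex_inj (addrI (1 : F))) (bigD1 (0 : F)) //= addr0 psi1.
by move/eqP; rewrite addrC addr_eq0 => /eqP.
Qed.

Lemma sum_psi_pair t : t != 0 -> t != 1 ->
  \sum_y psi (1 - t * y) * psi (1 - y) = - psi t.
Proof.
move=> t0 t1; rewrite (reindex_inj one_sub_inj) /=.
have c0 : t^-1 - 1 != 0 by rewrite subr_eq0 invr_eq1.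
rewrite -[RHS]mulr1 mulNr -mulrN -(sum_psi_shift c0) mulr_sumr.
apply: eq_bigr => z _; rewrite [RHS]mulrA -(psiM t); congr (psi _ * psi _).
  transitivity (t * z + t / t - t); last by ring.
  by rewrite divff //; ring.
by rewrite opprB addrC subrK.
Qed.

Definition jacobi := \sum_x chi x * psi (1 - x).

(** Substitute x = t y in the double sum: the sum over y becomes the quadratic sum of
    sum_psi_pair, and what remains are sums of nontrivial characters. *)
Lemma jacobi_norm : (\sum_y chi' y * psi (1 - y)) * jacobi = #|F|%:R.
Proof.
transitivity (\sum_(y | y != 0) \sum_t chi t * (psi (1 - t * y) * psi (1 - y))).
  rewrite mulr_suml (bigD1 (0 : F)) //= chi'0 !mul0r add0r.
  apply: eq_bigr => y y0; rewrite /jacobi (reindex_inj (mulIf y0)) mulr_sumr.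
  apply: eq_bigr => t _; rewrite chiM.
  transitivity ((chi' y * chi y) * (chi t * (psi (1 - t * y) * psi (1 - y)))); first by ring.
  by rewrite chiV // mul1r.
rewrite exchange_big /=.
transitivity (\sum_t chi t * (\sum_y psi (1 - t * y) * psi (1 - y))).
  rewrite -[RHS]subr0 -[X in _ - X]sum_chi -sumrB; apply: eq_bigr => t _.
  rewrite [X in _ = _ * X - _](bigD1 (0 : F)) //= mulr0 subr0 psi1 mulr1 mulrDr mulr1 addrAC subrr add0r.
  by rewrite mulr_sumr.
have sum1 : \sum_y psi (1 - 1 * y) * psi (1 - y) = #|F|%:R - 1.
  rewrite (reindex_inj one_sub_inj) (bigD1 (0 : F)) //= !mul1r subr0 subrr psi0 mul0r add0r.
  rewrite (eq_bigr (fun _ => 1)) => [|y y0]; last by rewrite mul1r opprB addrC subrK psi_sq.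
  rewrite sumr_const (_ : #|_| = #|F|.-1); last exact: (cardC1 (0 : F)).
  by rewrite -subn1 natrB //; apply/card_gt0P; exists 0.
rewrite (bigD1 (0 : F)) //= chi0 mul0r add0r (bigD1 (1 : F)) ?oner_eq0 //= chi1 mul1r sum1.
rewrite (eq_bigr (fun t => - (chi t * psi t))) => [|t /andP[t0 t1]]; last first.
  by rewrite sum_psi_pair // mulrN.
rewrite sumrN; have := sum_chi_psi.
rewrite (bigD1 (0 : F)) //= chi0 mul0r add0r (bigD1 (1 : F)) ?oner_eq0 //= chi1 psi1 mul1r => /eqP.
by rewrite addrC addr_eq0 => /eqP ->; rewrite opprK subrK.
Qed.

(** The rotation (x,y,z) |-> (y,z,x) of the plane x + y + z = 1 has order 3 and the single
    fixed point x = y = z = 1/3.  To count the other orbits, choose in each of them the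
    triple that starts with its smallest entry, and with the last one of a run of equal
    smallest entries. *)
Lemma sum_cyclic (h : F -> F -> F -> G) : (3%:R : F) != 0 ->
    (forall x y z, h y z x = h x y z) ->
  exists Z, \sum_x \sum_y h x y (1 - x - y) = h 3%:R^-1 3%:R^-1 3%:R^-1 + 3%:R * Z.
Proof.
move=> F3 h_cyc; pose r (x : F) : nat := enum_rank x.
have r_inj : injective r by move=> x y /ord_inj /enum_rank_inj.
(* of the three rotations of a non-constant triple exactly one satisfies C *)
pose C x y z := ((r x < r y) && (r x <= r z))%N.
pose hu (u : F * F) := h u.1 u.2 (1 - u.1 - u.2).
pose Cu (u : F * F) := C u.1 u.2 (1 - u.1 - u.2).
pose rot (u : F * F) := (u.2, 1 - u.1 - u.2).
have rot_third u : 1 - (rot u).1 - (rot u).2 = u.1 by rewrite /rot /=; ring.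
have rot_inj : injective rot.
  by move=> [x y] [x' y'] [-> e]; congr (_, _); move/addIr/addrI/oppr_inj: e.
have hu_rot u : hu (rot u) = hu u by rewrite /hu rot_third h_cyc.
pose t := 3%:R^-1 : F; pose fixpt := (t, t).
have t3 : 1 - t - t = t by apply: (mulfI F3); rewrite !mulrBr /t divff // mulr1; ring.
have Cu1 u : (u != fixpt) -> ((Cu u + Cu (rot u) + Cu (rot (rot u)))%N = 1)%N.
  case: u => x y u_fix; rewrite /Cu !rot_third /= /C.
  set z := 1 - x - y; have -> : 1 - y - z = x by rewrite /z; ring.
  have not_all : ~~ ((r x == r y) && (r y == r z)).
    apply: contra u_fix => /andP[/eqP/r_inj exy /eqP/r_inj eyz].
    have x3 : 3%:R * x = 1.
      by transitivity (x + y + z); [rewrite -eyz -exy; ring | rewrite /z; ring].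
    have ex : x = t by apply: (mulfI F3); rewrite x3 divff.
    by rewrite -exy ex.
  move: (r x) (r y) (r z) not_all => a b c.
  case: (ltngtP a b) => ab; case: (ltngtP b c) => bc; case: (ltngtP c a) => ca //=; try lia.
have Cufix : Cu fixpt = false by rewrite /Cu /C /= t3 ltnn.
have rotfix : rot fixpt = fixpt by rewrite /rot /= t3.
exists (\sum_u hu u * (Cu u)%:R).
rewrite (pair_big_dep xpredT (fun _ => xpredT) (fun x y => h x y (1 - x - y))) /= -/hu.
have rotS (f : F * F -> nat) : \sum_u hu u * (f u)%:R = \sum_u hu u * (f (rot u))%:R.
  by rewrite (reindex_inj rot_inj); apply: eq_bigr => u _; rewrite hu_rot.
have -> : 3%:R * (\sum_u hu u * (Cu u)%:R) = \sum_u hu u * (Cu u + Cu (rot u) + Cu (rot (rot u)))%:R.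
  transitivity (\sum_u hu u * (Cu u)%:R + \sum_u hu u * (Cu (rot u))%:R + \sum_u hu u * (Cu (rot (rot u)))%:R).
    rewrite -(rotS (fun u => Cu (rot u))) -(rotS Cu); ring.
  by rewrite -!big_split; apply: eq_bigr => u _; rewrite /= !natrD; ring.
rewrite (bigD1 fixpt) //= [X in _ = _ + X](bigD1 fixpt) //= rotfix rotfix Cufix mulr0 add0r.
rewrite {1}/hu /= t3; congr (_ + _); apply: eq_bigr => u u_fix.
by rewrite Cu1 // mulr1.
Qed.

Hypothesis F2 : (2%:R : F) != 0.
Hypothesis psi_nonsq : forall x, (forall a, a ^+ 2 != x) -> psi x = -1.

Lemma sum_over_squares (f : F -> G) : \sum_v f (v ^+ 2) = \sum_x f x * (1 + psi x).
Proof.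
rewrite (partition_big (fun v : F => v ^+ 2) predT) //=; apply: eq_bigr => x _.
rewrite (eq_bigr (fun _ => f x)) => [|v /eqP-> //]; rewrite sumr_const -mulr_natr; congr (_ * _).
have [/existsP[a /eqP <-]|] := boolP [exists a, a ^+ 2 == x]; last first.
  rewrite negb_exists => /forallP nsq; rewrite psi_nonsq // subrr.
  by rewrite (_ : #|_| = 0%N) //; apply: eq_card0 => v; apply/negbTE/nsq.
have [->|a0] := eqVneq a 0.
  rewrite expr0n /= psi0 addr0 (_ : #|_| = 1%N) //.
  by apply: etrans (card1 (0 : F)); apply: eq_card => v; rewrite !unfold_in /=; exact: sqrf_eq0.
rewrite expr2 psiM psi_sq // -expr2 (_ : #|_| = 2%N) //.
rewrite (eq_card (_ : _ =i pred2 a (- a))) ?card2; last by move=> v; rewrite !unfold_in /=; exact: eqf_sqr.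
rewrite -subr_eq0 opprK -mulr2n -mulr_natl mulf_eq0 negb_or a0 F2 //.
Qed.

(** Since 4x(1 - x) = 1 - (1 - 2x)^2, the left-hand side is a sum over squares, that is
    the sum of chi(1 - w) (1 + psi w). *)
Lemma jacobi_chi_chi : chi 4%:R * (\sum_x chi x * chi (1 - x)) = jacobi.
Proof.
have e4 x : chi 4%:R * (chi x * chi (1 - x)) = chi (1 - (1 - 2%:R * x) ^+ 2).
  by rewrite -!chiM; congr chi; ring.
rewrite mulr_sumr (eq_bigr _ (fun x _ => e4 x)).
have inj2 : injective (fun x : F => 1 - 2%:R * x).
  by move=> x y /addrI /oppr_inj /(mulfI F2).
have -> : \sum_x chi (1 - (1 - 2%:R * x) ^+ 2) = \sum_v chi (1 - v ^+ 2).
  by rewrite [RHS](reindex_inj inj2).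
rewrite (sum_over_squares (fun w => chi (1 - w))) /=.
rewrite (reindex_inj one_sub_inj) /= /jacobi.
transitivity (\sum_x chi x + \sum_x chi x * psi (1 - x)); last by rewrite sum_chi add0r.
by rewrite -big_split; apply: eq_bigr => x _; rewrite /= subKr mulrDr mulr1.
Qed.

(** For fixed x, scale y by 1 - x. *)
Lemma sum_chi3 : \sum_x \sum_y chi x * chi y * chi (1 - x - y) =
  jacobi * \sum_x chi x * chi (1 - x).
Proof.
rewrite /jacobi mulr_suml; apply: eq_bigr => x _; have [x1|x1] := eqVneq (1 - x) 0.
  rewrite x1 psi0 mulr0 mul0r; transitivity (chi x * chi (-1) * \sum_y psi y); last first.
    by rewrite sum_psi mulr0.
  rewrite mulr_sumr; apply: eq_bigr => y _; rewrite sub0r -(mulN1r y) chiM psiE; ring.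
rewrite (reindex_inj (mulfI x1)) mulr_sumr; apply: eq_bigr => u _.
have -> : 1 - x - (1 - x) * u = (1 - x) * (1 - u) by ring.
by rewrite !chiM psiE; ring.
Qed.

Lemma jacobi_sq_mod3 : (3%:R : F) != 0 -> (forall x, x != 0 -> chi x ^+ 4 = 1) ->
  exists Z, jacobi ^+ 2 = psi 2%:R * (chi 3%:R + 3%:R * Z).
Proof.
move=> F3 chi4; pose h x y z := chi x * chi y * chi z.
have [|Z sumE] := @sum_cyclic h F3; first by move=> x y z; rewrite /h; ring.
exists Z; have <- : h 3%:R^-1 3%:R^-1 3%:R^-1 = chi 3%:R.
  have inv3 : chi 3%:R * chi 3%:R^-1 = 1 by rewrite -chiM divff.
  rewrite -[RHS]mulr1 -(chi4 (3%:R^-1)) ?invr_eq0 // -[LHS]mul1r -inv3 /h; ring.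
rewrite -sumE sum_chi3; have := jacobi_chi_chi.
have -> : chi 4%:R = psi 2%:R by rewrite psiE expr2 -chiM -natrM.
set S := \sum_x _ => J2.
by rewrite expr2 -{2}J2; ring.
Qed.

End JacobiSums.

(** * The quartic character of F_p *)

Section QuarticCharacter.
Variables (p m : nat) (w : 'F_p).
Hypotheses (p_prime : prime p) (def_p : p = (4 * m).+1) (w_sq : w * w = -1).

Lemma m_gt0 : (0 < m)%N.
Proof. by case: m def_p => // p1; have := prime_gt1 p_prime; rewrite p1. Qed.

Lemma Fp_nat_neq0 k : (0 < k < p)%N -> (k%:R : 'F_p) != 0.
Proof.
move=> /andP[k_gt0 lt_kp]; apply/eqP => k0.
by have := val_Fp_nat p_prime k; rewrite k0 modn_small //= => e; rewrite -e in k_gt0.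
Qed.

Lemma Fp_two_neq0 : (2%:R : 'F_p) != 0.
Proof. by apply: Fp_nat_neq0; have := m_gt0; rewrite def_p; lia. Qed.

Lemma Fp_neqN (x : 'F_p) : x != 0 -> x != - x.
Proof.
move=> x0; rewrite -subr_eq0 opprK -mulr2n -mulr_natl mulf_eq0 negb_or x0 andbT.
exact: Fp_two_neq0.
Qed.

Lemma w_neq0 : w != 0.
Proof. by apply: contra_eq_neq w_sq => ->; rewrite mul0r eq_sym oppr_eq0 oner_eq0. Qed.

(** The inverse, on the units of Z[i] and 0, of the reduction modulo p that sends i to w. *)
Definition unit_of_Fp (y : 'F_p) : gint :=
  if y == 0 then 0 else if y == 1 then 1 else if y == -1 then -1 
  else if y == w then gi else - gi.

(** The exponent 3m, rather than m, is chosen so that the Jacobi sum below is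
    invertible under the reduction modulo p that sends i to w. *)
Definition quartic_char (x : 'F_p) : gint := unit_of_Fp (x ^+ (3 * m)).
Local Notation chi := quartic_char.

Lemma w_neq1 : w != 1.
Proof.
by apply: contra_eq_neq w_sq => ->; rewrite mul1r Fp_neqN // oner_eq0.
Qed.

Lemma w_neqN1 : w != -1.
Proof.
by apply: contra_eq_neq w_sq => ->; rewrite mulrNN mul1r Fp_neqN // oner_eq0.
Qed.

Lemma unit_of_Fp_gev u : u \in gunits0 -> unit_of_Fp (gev w u) = u.
Proof.
have one0 := oner_eq0 'F_p.
rewrite !inE => /or4P[/eqP->|/eqP->|/eqP->|/orP[/eqP->|/eqP->]]; rewrite /unit_of_Fp.
- by rewrite gev0 eqxx.
- by rewrite gev1 one0 eqxx.
- by rewrite gevN gev1 oppr_eq0 one0 eq_sym (negbTE (Fp_neqN _)) ?one0 // eqxx.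
- by rewrite gev_i (negbTE w_neq0) (negbTE w_neq1) (negbTE w_neqN1) eqxx.
rewrite gevN gev_i oppr_eq0 (negbTE w_neq0) eqr_oppLR (negbTE w_neqN1) eqr_opp (negbTE w_neq1).
by rewrite eq_sym (negbTE (Fp_neqN w_neq0)).
Qed.

Lemma unit_of_Fp_in y : unit_of_Fp y \in gunits0.
Proof. by rewrite /unit_of_Fp; do ?[case: ifP => _ //]. Qed.

Lemma gev_unit_of_Fp y : y * y ^+ 4 = y -> gev w (unit_of_Fp y) = y.
Proof.
move=> y5; rewrite /unit_of_Fp; case: eqP => [->|/eqP y0]; first by rewrite gev0.
have y4 : y ^+ 4 = 1 by apply: (mulfI y0); rewrite y5 mulr1.
case: eqP => [->|/eqP y1]; first by rewrite gev1.
case: eqP => [->|/eqP yN1]; first by rewrite gevN gev1.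
case: eqP => [->|/eqP yw]; first by rewrite gev_i.
have : (y - 1) * (y + 1) * (y - w) * (y + w) = 0.
  transitivity (y ^+ 4 - 1 - (y ^+ 2 - 1) * (w * w - (-1))); first by ring.
  by rewrite y4 w_sq !subrr mulr0 subr0.
move/eqP; rewrite !mulf_eq0 !subr_eq0 (negbTE y1) (negbTE yw) addr_eq0 (negbTE yN1) addr_eq0 /=.
by move=> /eqP->; rewrite gevN gev_i.
Qed.

Lemma chi_in x : chi x \in gunits0. Proof. exact: unit_of_Fp_in. Qed.

Lemma Fp_exp4 (x : 'F_p) : x != 0 -> x ^+ (4 * m) = 1.
Proof.
move=> x0; have expp : x ^+ p = x by have := expf_card x; rewrite card_Fp.
by apply: (mulfI x0); rewrite mulr1 -exprS -def_p.
Qed.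

Lemma gev_chi x : gev w (chi x) = x ^+ (3 * m).
Proof.
rewrite /quartic_char gev_unit_of_Fp //; have [->|x0] := eqVneq x 0.
  by rewrite expr0n muln_eq0 (gtn_eqF m_gt0) /= mul0r.
have -> : (x ^+ (3 * m)) ^+ 4 = (x ^+ (4 * m)) ^+ 3 by rewrite -!exprM; congr (_ ^+ _); lia.
by rewrite Fp_exp4 // expr1n mulr1.
Qed.

(** Both sides are 0 or units with the same reduction modulo p, and unit_of_Fp recovers
    such numbers from their reduction. *)
Lemma chiM x y : chi (x * y) = chi x * chi y.
Proof.
rewrite -[RHS]unit_of_Fp_gev; first by rewrite gevM // !gev_chi -exprMn.
by apply: gunits0M; apply: chi_in.
Qed.

Lemma chi0 : chi 0 = 0.
Proof. by rewrite /quartic_char expr0n muln_eq0 (gtn_eqF m_gt0) /= /unit_of_Fp eqxx. Qed.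

Lemma chi1 : chi 1 = 1.
Proof. by rewrite /quartic_char expr1n /unit_of_Fp oner_eq0 eqxx. Qed.

Lemma chi_neq0 x : x != 0 -> chi x != 0.
Proof.
apply: contra_neq => chi_x; have := gev_chi x.
by rewrite chi_x gev0 => /esym/eqP; rewrite expf_eq0 => /andP[_ /eqP].
Qed.

Lemma chi_conj x : x != 0 -> gconj (chi x) * chi x = 1.
Proof. by move=> x0; apply: gunits0_conj; rewrite ?chi_in ?chi_neq0. Qed.

Lemma chi_exp4 x : x != 0 -> chi x ^+ 4 = 1.
Proof.
move=> x0; have := chi_in x; have := chi_neq0 x0.
have : all (fun u => (u != 0) ==> (u ^+ 4 == 1)) gunits0 by [].
by move=> /allP H u0 /H; rewrite u0 => /eqP.
Qed.

Definition quadratic_char x := chi x ^+ 2.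
Local Notation psi := quadratic_char.

Lemma psiM x y : psi (x * y) = psi x * psi y.
Proof. by rewrite /quadratic_char chiM exprMn. Qed.

Lemma psi0 : psi 0 = 0. Proof. by rewrite /quadratic_char chi0 expr0n. Qed.
Lemma psi1 : psi 1 = 1. Proof. by rewrite /quadratic_char chi1 expr1n. Qed.

Lemma psi_cases x : x != 0 -> psi x = 1 \/ psi x = -1.
Proof.
move=> x0; have := chi_in x; have := chi_neq0 x0.
have : all (fun u => (u != 0) ==> ((u ^+ 2 == 1) || (u ^+ 2 == -1))) gunits0 by [].
by move=> /allP H u0 /H; rewrite u0 => /orP[]/eqP; [left|right].
Qed.

Lemma psi_sq x : x != 0 -> psi x * psi x = 1.
Proof. by move=> x0; rewrite -expr2 /quadratic_char -exprM chi_exp4. Qed.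

Lemma nonresidue_exists : exists2 g, g != 0 & psi g = -1.
Proof.
have p_odd : odd p by rewrite def_p; lia.
have p_gt2 : (2 < p)%N by have := m_gt0; lia.
have ndvd : ~~ (p.-1 %| 2 * m)%N.
  rewrite def_p /=; apply/negP => /dvdn_leq; have := m_gt0; lia.
have [g g0 g2m] := exists_exp_neq1 p_prime p_odd p_gt2 ndvd.
exists g => //.
case: (psi_cases g0) => // psi_g.
case/eqP: g2m; have := congr1 (gev w) psi_g.
rewrite gev1 /quadratic_char expr2 gevM // !gev_chi -exprD => <-.
rewrite (_ : (3 * m + 3 * m = 4 * m + 2 * m)%N); last by lia.
by rewrite exprD Fp_exp4 // mul1r.
Qed.

(** Multiplying the argument by g multiplies the sum by c, hence by c^2 = -1 when this is
    done twice. *)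
Lemma sum_twisted (f : 'F_p -> gint) g c : g != 0 -> c * c = -1 ->
  (forall x, f (g * x) = c * f x) -> \sum_x f x = 0.
Proof.
move=> g0 c2 fg; set S := \sum_x _.
have cS : S = c * S.
  by rewrite {1}/S (reindex_inj (mulfI g0)) mulr_sumr; apply: eq_bigr => x _.
by apply: gint_double_eq0; rewrite {1}cS {1}cS mulrA c2 mulN1r.
Qed.

Lemma sum_chi : \sum_x chi x = 0.
Proof.
have [g g0 psi_g] := nonresidue_exists.
by apply: (sum_twisted g0 (c := chi g)) => [|x]; rewrite ?chiM // -expr2.
Qed.

Lemma sum_psi : \sum_x psi x = 0.
Proof.
have [g g0 psi_g] := nonresidue_exists; set S := \sum_x _.
apply: gint_double_eq0; rewrite -mulN1r -psi_g {1}/S (reindex_inj (mulfI g0)) mulr_sumr.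
by apply: eq_bigr => x _; rewrite psiM.
Qed.

Lemma sum_chi_psi : \sum_x chi x * psi x = 0.
Proof.
have [g g0 psi_g] := nonresidue_exists.
apply: (sum_twisted g0 (c := chi g * psi g)) => [|x]; last by rewrite chiM psiM mulrACA.
by rewrite mulrACA -!expr2 -/(quadratic_char g) psi_g.
Qed.

Definition quartic_jacobi := \sum_x chi x * psi (1 - x).

End QuarticCharacter.

(** * The quartic Jacobi sum *)

Section QuarticJacobiSum.
Variables (p m : nat) (w : 'F_p).
Hypotheses (p_prime : prime p) (def_p : p = (4 * m).+1) (w_sq : w * w = -1).
Local Notation chi := (quartic_char m w).
Local Notation psi := (quadratic_char m w).

Let m_pos : (0 < m)%N. Proof. exact: m_gt0 p_prime def_p. Qed.

Lemma Fp_prim_root : exists g : 'F_p, (4 * m).-primitive_root g.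
Proof.
have := @has_prim_root _ (4 * m) (enum [pred y : 'F_p | y != 0]) ltac:(lia).
rewrite enum_uniq -cardE => /(_ _ isT).
have -> : #|[pred y : 'F_p | y != 0]| = (4 * m)%N.
  have -> : (4 * m = p.-1)%N by lia.
  by have := cardC1 (0 : 'F_p); rewrite (card_Fp p_prime) => <-; apply: eq_card.
have -> : all (4 * m).-unity_root (enum [pred y : 'F_p | y != 0]).
  apply/allP => y; rewrite mem_enum inE => y0; apply/unity_rootP.
  exact: Fp_exp4 p_prime def_p _ y0.
by move=> /(_ isT (leqnn _)) /hasP[g _ gP]; exists g.
Qed.

(** Euler's criterion, from a primitive root. *)
Lemma psi_nonsquare x : (forall a, a ^+ 2 != x) -> psi x = -1.
Proof.
move=> nsq; have x0 : x != 0 by have := nsq 0; rewrite expr0n /= eq_sym.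
case: (psi_cases p_prime def_p w_sq x0) => // psi_x.
have x2m : x ^+ (2 * m) = 1.
  have := congr1 (gev w) psi_x; rewrite gev1 /quadratic_char expr2 gevM // !(gev_chi p_prime def_p w_sq) -exprD => <-.
  rewrite (_ : (3 * m + 3 * m = 4 * m + 2 * m)%N); last by lia.
  by rewrite exprD (Fp_exp4 p_prime def_p x0) mul1r.
have [g g_prim] := Fp_prim_root.
have [i def_x] := prim_rootP g_prim (Fp_exp4 p_prime def_p x0).
have /dvdnP[q def_q] : (4 * m %| i * (2 * m))%N.
  by rewrite (prim_order_dvd g_prim) exprM -def_x x2m.
have def_i : (i : nat) = (q * 2)%N by nia.
by case/eqP: (nsq (g ^+ q)); rewrite -exprM -def_i def_x.
Qed.

(** Divisibility by 2 + 2i. *)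
Definition normal_gint (z : gint) := (4 %| gre z + gim z)%Z && (2 %| gim z)%Z.

Lemma normal_gintD z1 z2 : normal_gint z1 -> normal_gint z2 -> normal_gint (z1 + z2).
Proof.
by rewrite /normal_gint greD gimD => /andP[? ?] /andP[? ?]; apply/andP; split; lia.
Qed.

(** For x other than 0 and 1, chi(x) - 1 is divisible by 1 - i and psi(1 - x) - 1 by 2.
    Summing the products of these differences gives J + p. *)
Lemma jac_normal : normal_gint (quartic_jacobi m w + p%:R).
Proof.
pose P x := (x != 0 :> 'F_p) && (x != 1).
have sumP (f : 'F_p -> gint) : \sum_x f x = f 0 + (f 1 + \sum_(x | P x) f x).
  by rewrite (bigD1 (0 : 'F_p)) // (bigD1 (1 : 'F_p)) ?oner_eq0.
have neg1 (s : gint) : 0 = 1 + s -> s = -1.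
  by move=> e; apply: (addrI 1); rewrite -e subrr.
have -> : quartic_jacobi m w + p%:R = \sum_(x | P x) (chi x - 1) * (psi (1 - x) - 1).
  have expand (G : comNzRingType) (a b : G) : (a - 1) * (b - 1) = a * b - a + (1 - b) by ring.
  rewrite (eq_bigr _ (fun x _ => expand _ (chi x) (psi (1 - x)))) big_split /= !sumrB.
  have := sumP (fun x => chi x * psi (1 - x)).
  rewrite (chi0 w p_prime def_p) mul0r add0r subrr (psi0 w p_prime def_p) mulr0 add0r => <-.
  have := sumP chi; rewrite (chi0 w p_prime def_p) add0r chi1 (sum_chi p_prime def_p w_sq).
  move=> /neg1 ->.
  have := sumP (fun x => psi (1 - x)).
  rewrite subr0 subrr (psi0 w p_prime def_p) add0r psi1.
  have -> : \sum_x psi (1 - x) = 0.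
    by rewrite -[RHS](sum_psi p_prime def_p w_sq) [RHS](reindex_inj (@one_sub_inj 'F_p)).
  move=> /neg1 ->.
  have -> : p%:R = 1 + (1 + \sum_(x | P x) 1) :> gint.
    by rewrite -(sumP (fun=> 1)) sumr_const card_Fp.
  have fin (G : comNzRingType) (a b : G) : a + (1 + (1 + b)) = a - -1 + (b - -1) by ring.
  exact: fin.
apply: (big_ind normal_gint) => [//||x /andP[x0 x1]]; first exact: normal_gintD.
have y0 : 1 - x != 0 by rewrite subr_eq0 eq_sym.
have := chi_in m w x; have := chi_neq0 p_prime def_p w_sq x0.
case: (psi_cases p_prime def_p w_sq y0) => ->; first by rewrite subrr mulr0.
have : all (fun u => (u != 0) ==> normal_gint ((u - 1) * (-1 - 1))) gunits0 by [].
by move=> /allP H u0 /H; rewrite u0.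
Qed.

Lemma jac_norm : gre (quartic_jacobi m w) ^+ 2 + gim (quartic_jacobi m w) ^+ 2 = p%:Z.
Proof.
have gconj_jac : gconj (quartic_jacobi m w) = \sum_x gconj (chi x) * psi (1 - x).
  rewrite /quartic_jacobi (big_morph gconj gconjD gconj0); apply: eq_bigr => x _.
  rewrite gconjM; congr (_ * _); have [->|x0] := eqVneq (1 - x) 0.
    by rewrite (psi0 w p_prime def_p).
  by case: (psi_cases p_prime def_p w_sq x0) => ->.
have := @jacobi_norm 'F_p gint chi (fun x => gconj (chi x)) psi
  (chiM p_prime def_p w_sq) (chi0 w p_prime def_p) (chi1 m w) (chi_conj p_prime def_p w_sq).
rewrite (chi0 w p_prime def_p) => /(_ erefl (fun x => erefl) (psi_sq p_prime def_p w_sq)).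
move=> /(_ (sum_chi p_prime def_p w_sq) (sum_psi p_prime def_p w_sq) (sum_chi_psi p_prime def_p w_sq)).
rewrite -gconj_jac /jacobi -/(quartic_jacobi m w) (card_Fp p_prime) => /(congr1 gre).
by rewrite gre_nat greM /= mulNr opprK -!expr2 => ->; rewrite natz.
Qed.

Lemma jac_sq_mod3 : exists Z, quartic_jacobi m w ^+ 2 = psi 2%:R * (chi 3%:R + 3%:R * Z).
Proof.
have F2 : (2%:R : 'F_p) != 0 by apply: Fp_nat_neq0; lia.
have F3 : (3%:R : 'F_p) != 0 by apply: Fp_nat_neq0; lia.
exact: (@jacobi_sq_mod3 'F_p gint chi psi (chiM p_prime def_p w_sq) (chi0 w p_prime def_p)
  (chi1 m w) (fun x => erefl) (psi_sq p_prime def_p w_sq)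
  (sum_chi p_prime def_p w_sq) (sum_psi p_prime def_p w_sq) F2 psi_nonsquare F3 (chi_exp4 p_prime def_p w_sq)).
Qed.

End QuarticJacobiSum.

(** * The truncated sum as the image of a Gaussian integer *)

Section Assembly.
Variables (R : comUnitRingType) (p l v : nat).
Hypothesis p_sq0 : p%:R * p%:R = 0 :> R.
Hypothesis unit_lt_p : forall k, (0 < k < p)%N -> (k%:R : R) \is a GRing.unit.
Hypotheses (p_prime : prime p) (v_le1 : (v <= 1)%N) (def_p : p = (12 * l + 4 * v).+1).
Let m := (3 * l + v)%N.
Let p_odd : odd p. Proof. by rewrite def_p; lia. Qed.
Let def_p4 : p = (4 * m).+1. Proof. by rewrite def_p /m; lia. Qed.
Let p_gt2 : (2 < p)%N. Proof. by have := m_gt0 p_prime def_p4; lia. Qed.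
Let unit12R : (12%:R : R) \is a GRing.unit.
Proof. exact: (unit12 unit_lt_p v_le1 def_p (ltnW p_gt2)). Qed.

Local Notation bin63 k := ('C(6 * k, 3 * k) * 'C(3 * k, k))%N.

(** The ratio of (6k)! / ((3k)! (2k)! k!) at k + 1 and at k. *)
Lemma bin63S k : (k.+1 ^ 2 * bin63 k.+1 = 12 * ((6 * k + 1) * (6 * k + 5)) * bin63 k)%N.
Proof.
have pos : (0 < (3 * k)`! * (2 * k)`! * k`!)%N by rewrite !muln_gt0 !fact_gt0.
have factE n : (bin63 n * ((3 * n)`! * (2 * n)`! * n`!) = (6 * n)`!)%N.
  rewrite -(@bin_fact (6 * n) (3 * n)); last by lia.
  rewrite (_ : 6 * n - 3 * n = 3 * n)%N; last by lia.
  rewrite -{3}(@bin_fact (3 * n) n); last by lia.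
  rewrite (_ : 3 * n - n = 2 * n)%N; last by lia.
  by ring.
have e1 := factE k.+1.
rewrite (_ : 6 * k.+1 = (6 * k).+4.+2)%N in e1; last by lia.
rewrite (_ : 3 * k.+1 = (3 * k).+3)%N in e1; last by lia.
rewrite (_ : 2 * k.+1 = (2 * k).+2)%N in e1; last by lia.
rewrite !factS -factE in e1.
rewrite (_ : 6 * k.+1 = (6 * k).+4.+2)%N; last by lia.
rewrite (_ : 3 * k.+1 = (3 * k).+3)%N; last by lia.
move: e1 pos; set c' := ('C(_.+4.+2, _) * _)%N; set c := bin63 k; set D := ((3 * k)`! * (2 * k)`! * k`!)%N => e1 pos.
pose X := ((3 * k).+3 * (3 * k).+2 * (3 * k).+1 * (2 * k).+1)%N.
have posX : (0 < D * (2 * X))%N by rewrite muln_gt0 pos /X !muln_gt0.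
apply/eqP; rewrite -(eqn_pmul2l posX); apply/eqP.
transitivity (c' * (((3 * k).+3 * ((3 * k).+2 * ((3 * k).+1 * (3 * k)`!))) *
  ((2 * k).+2 * ((2 * k).+1 * (2 * k)`!)) * (k.+1 * k`!)))%N.
  rewrite /X /D; ring.
rewrite e1 /X -/c; ring.
Qed.

Let x : R := - (2%:R / 12%:R).
Let a : R := (2 * l)%:R + p%:R * x.

Let twelve_a : 12%:R * a = - (2%:R * (4 * v + 1)%:R).
Proof.
transitivity (12%:R * (2 * l)%:R - p%:R * 2%:R * (12%:R / 12%:R) : R); first by rewrite /a /x; ring.
have pE : p%:R = 12%:R * l%:R + 4%:R * v%:R + 1 :> R by rewrite def_p -natr1 natrD !natrM.
by rewrite divrr // mulr1 pE natrD !natrM; ring.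
Qed.

(** For a = 2l - p/6 = -u/6 both factors of leg_coef are, in some order, i + 1/6 and
    i + 5/6. *)
Lemma leg_coef_bin k : (k < p)%N -> leg_coef a k * 432%:R ^+ k = (bin63 k)%:R.
Proof.
elim: k => [|k IHk] lt_kp; first by rewrite /leg_coef big_ord0 expr0 mul1r !muln0 !bin0.
have U : (k.+1%:R ^+ 2 : R) \is a GRing.unit by rewrite unitrX // unit_lt_p.
apply: (mulrI U); rewrite mulrA (leg_coefS unit_lt_p) // -[k.+1%:R ^+ 2 in RHS]natrX -natrM bin63S natrM -IHk; last exact: ltnW.
rewrite exprS.
have quad : (k%:R - a) * (k.+1%:R + a) * 432%:R = (12 * ((6 * k + 1) * (6 * k + 5)))%:R.
  transitivity (3%:R * (12%:R * k%:R - 12%:R * a) * (12%:R * k.+1%:R + 12%:R * a) : R); first by ring.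
  rewrite twelve_a -[k.+1%:R]natr1 natrM natrM.
  have [v_eq|v_eq] : v = 0%N \/ v = 1%N by lia.
    by rewrite v_eq !natrD; ring.
  by rewrite v_eq !natrD; ring.
by rewrite -quad; ring.
Qed.

(** Up to the factor -6, the progressions of leg_trunc_chain read backwards are those of
    progression_quotient_eq. *)
Lemma leg_trunc_value : leg_trunc p a = (-1) ^+ l * 3%:R ^+ (p * m) *
  ('C(2 * m, m)%:R * eps p (- ((harm R (2 * m) - harm R m) / 2%:R))).
Proof.
have M2 : (2 * m = 6 * l + 2 * v)%N by rewrite /m; lia.
rewrite M2.
apply: (@progression_quotient_eq R p p_sq0 unit_lt_p l v v_le1 def_p (ltnW p_gt2)
  (4 * l + v) (8 * l + 3 * v) m (6 * l + 2 * v) (5 * l + 2 * v) (7 * l + 2 * v)) => //.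
have chain := @leg_trunc_chain R p p_sq0 unit_lt_p p_odd p_gt2 l x ltac:(lia).
have half_p : p./2 = (6 * l + 2 * v)%N by lia.
rewrite half_p -/a in chain.
have U6 : ((- 6%:R) ^+ l : R) \is a GRing.unit.
  by rewrite unitrX // unitrN (natrM R 2 3) unitrM (unit2 unit_lt_p v_le1 def_p) ?(unit3 unit_lt_p v_le1 def_p) // ltnW.
have prodE c : (0 < c <= 2)%N -> \prod_(j < l) ((2 * j + c)%:R + p%:R * x) * (- 6%:R) ^+ l =
    \prod_(i < l) (12 * i + (4 * v + 13 - 6 * c))%:R :> R.
  move=> c_bounds; rewrite -[X in _ ^+ X]card_ord -prodr_const -big_split /=.
  rewrite (reindex_inj rev_ord_inj) /=; apply: eq_bigr => i _; have lt_il := ltn_ord i.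
  transitivity (p%:R * (12%:R / 12%:R) - (6 * (2 * (l - i.+1) + c))%:R : R).
    by rewrite natrM /x; ring.
  rewrite divrr // mulr1 -natrB; last by lia.
  by congr _%:R; lia.
have := prodE 1%N isT; have := prodE 2%N isT.
rewrite (_ : 4 * v + 13 - 6 * 2 = 4 * v + 1)%N; last by lia.
rewrite (_ : 4 * v + 13 - 6 * 1 = 4 * v + 7)%N; last by lia.
move=> <- <-.
have -> : eps p (- (harm R (6 * l + 2 * v) / 12%:R)) = eps p (x * (harm R (6 * l + 2 * v) / 2%:R)) :> R.
  rewrite /x; congr eps.
  transitivity (- (harm R (6 * l + 2 * v) / 12%:R * (2%:R / 2%:R)) : R); last by ring.
  by rewrite divrr ?mulr1 // unit_lt_p //; lia.
apply: (mulIr U6); rewrite -!mulrA.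
have odd_prod : \prod_(j < l) ((2 * j).+1%:R + p%:R * x) = \prod_(j < l) ((2 * j + 1)%:R + p%:R * x).
  by apply: eq_bigr => j _; rewrite addn1.
have even_prod : \prod_(j < l) ((2 * j.+1)%:R + p%:R * x) = \prod_(j < l) ((2 * j + 2)%:R + p%:R * x).
  by apply: eq_bigr => j _; rewrite mulnS addnC.
move: chain; rewrite odd_prod even_prod.
set A := \prod_(j < l) _; set B := \prod_(j < l) _; set N := (- 6%:R) ^+ l; set E := eps p _.
move=> chain; transitivity (leg_trunc p a * A * N * N); first by ring.
by rewrite chain; ring.
Qed.

Section Embedding.
Variable w : 'F_p.
Hypothesis w_sq : w * w = -1.
Let iota : R := teich R w.
Local Notation chi := (quartic_char m w).
Local Notation psi := (quadratic_char m w).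
Local Notation jac := (quartic_jacobi m w).

Lemma iota_sq : iota * iota = -1.
Proof.
by rewrite /iota -(teichM p_sq0 p_prime p_gt2) w_sq (teichN p_sq0 p_prime p_odd p_gt2) (teich1 p_sq0 p_prime p_gt2).
Qed.

(** The lift w |-> teich w carries evaluation at w in F_p to evaluation in Z/p^2. *)
Lemma gev_teich u : u \in gunits0 -> gev iota u = teich R (gev w u).
Proof.
have t1 := teich1 p_sq0 p_prime p_gt2.
have tN := teichN p_sq0 p_prime p_odd p_gt2.
rewrite !inE => /or4P[/eqP->|/eqP->|/eqP->|/orP[/eqP->|/eqP->]].
- by rewrite !gev0 (teich0 R p_gt2).
- by rewrite !gev1 t1.
- by rewrite !gevN !gev1 tN t1.
- by rewrite !gev_i.
by rewrite !gevN !gev_i tN.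
Qed.

Lemma gev_chiR y : gev iota (chi y) = teich R y ^+ (3 * m).
Proof.
by rewrite gev_teich ?chi_in // (gev_chi p_prime def_p4 w_sq) (teichX p_sq0 p_prime p_gt2).
Qed.

Lemma gev_psiR y : gev iota (psi y) = teich R y ^+ (2 * m).
Proof.
rewrite /quadratic_char expr2 (gevM iota_sq) !gev_chiR -exprD -!(teichX p_sq0 p_prime p_gt2); congr (teich R _).
have [->|y0] := eqVneq y 0.
  have := m_gt0 p_prime def_p4; move=> m0.
  by rewrite !expr0n; congr _%:R; congr nat_of_bool; lia.
have -> : (3 * m + 3 * m = 4 * m + 2 * m)%N by lia.
by rewrite exprD (Fp_exp4 p_prime def_p4 y0) mul1r.
Qed.

Lemma gev_jac : gev iota jac =
  - ((-1) ^+ m * ('C(2 * m, m)%:R * eps p (- ((harm R (2 * m) - harm R m) / 2%:R)))).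
Proof.
rewrite -(jacobi_sum_teich p_sq0 unit_lt_p p_prime p_odd p_gt2 def_p4).
rewrite /quartic_jacobi (big_morph (gev iota) (gevD iota) (gev0 iota)); apply: eq_bigr => y _.
by rewrite (gevM iota_sq) gev_chiR gev_psiR (teich_1sub p_sq0 p_prime p_odd p_gt2) -(exprM (1 - teich R y)).
Qed.

(** The sign can be read off in Z/p^2, where two_power_quarter computes 2^(2m). *)
Lemma psi_two : psi 2%:R = (-1) ^+ m.
Proof.
have U2 : (2%:R : R) \is a GRing.unit by apply: unit_lt_p; lia.
have gev_psi2 : gev iota (psi 2%:R) = (-1) ^+ m.
  have m0 := m_gt0 p_prime def_p4.
  rewrite gev_psiR (teich_nat p_sq0 p_prime p_gt2) -exprM mulnC exprM.
  rewrite (two_power_quarter p_sq0 unit_lt_p def_p4 m0) exprMn (epsX p_sq0).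
  set X := _ / _.
  rewrite (_ : eps p (X *+ p) = 1); last first.
    by rewrite /eps -(mulr_natr X) mulrCA p_sq0 mulr0 addr0.
  rewrite mulr1 -[(-1) ^+ m]signr_odd; case: (odd m); rewrite ?expr0 ?expr1n ?expr1 //.
  by rewrite -signr_odd p_odd.
have F2 : (2%:R : 'F_p) != 0 by apply: Fp_nat_neq0; lia.
have one_neqN1 : (1 : R) <> -1.
  move=> e; have : (2%:R : R) = 0 by rewrite -[2%:R]/(1 + 1) {1}e addNr.
  by move=> e2; move: U2; rewrite e2 unitr0.
rewrite -signr_odd in gev_psi2; rewrite -[RHS]signr_odd; move: gev_psi2.
case: (psi_cases p_prime def_p4 w_sq F2) => ->; case: (odd m) => //=;
  rewrite ?expr1 ?expr0 ?gevN !gev1 //.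
by move/esym.
Qed.

(** The factor 3^(pm) is the image of the inverse of chi(3), that is of its conjugate. *)
Lemma leg_trunc_gauss :
  leg_trunc p a = gev iota ((-1) ^+ l * gconj (chi 3%:R) * (- ((-1) ^+ m * jac))).
Proof.
have gev_sign n : gev iota ((-1) ^+ n) = (-1) ^+ n.
  by rewrite -signr_odd -[RHS]signr_odd; case: (odd n); rewrite ?expr1 ?expr0 ?gevN gev1.
rewrite !(gevM iota_sq) gevN (gevM iota_sq) !gev_sign gev_jac leg_trunc_value.
rewrite !mulrN opprK; set A := _ * eps p _.
rewrite (mulrA ((-1) ^+ m) ((-1) ^+ m)) sign_sq mul1r; congr (_ * _ * _).
have F3 : (3%:R : 'F_p) != 0 by apply: Fp_nat_neq0; lia.
have := chi_conj p_prime def_p4 w_sq F3.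
move/(congr1 (gev iota)); rewrite (gevM iota_sq) gev1 gev_chiR (teich_nat p_sq0 p_prime p_gt2) => inv3.
have inv3' : 3%:R ^+ (p * m) * (3%:R ^+ p) ^+ (3 * m) = 1 :> R.
  rewrite -(teich_nat p_sq0 p_prime p_gt2) exprM -(teich_nat p_sq0 p_prime p_gt2) -exprD.
  rewrite -(teichX p_sq0 p_prime p_gt2) (_ : m + 3 * m = 4 * m)%N; last by lia.
  by rewrite (Fp_exp4 p_prime def_p4 F3) (teich1 p_sq0 p_prime p_gt2).
have U : ((3%:R ^+ p) ^+ (3 * m) : R) \is a GRing.unit.
  by rewrite !unitrX // (unit3 unit_lt_p v_le1 def_p (ltnW p_gt2)).
by apply: (mulIr U); rewrite inv3 inv3'.
Qed.

End Embedding.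
End Assembly.

(** * Identification of the Gaussian integer *)

Lemma prime_dvdzM (p : nat) (x y : int) : prime p ->
  (p%:Z %| x * y)%Z -> (p%:Z %| x)%Z \/ (p%:Z %| y)%Z.
Proof. by move=> p_prime; rewrite !dvdzE abszM Euclid_dvdM // => /orP. Qed.

Lemma odd_decomp (a : int) : (2 %| a - 1)%Z -> exists q, a = 2 * q + 1.
Proof. by case/dvdzP => q def_a; exists q; rewrite mulrC -def_a subrK. Qed.

(** If p divides a d - b c, the identity (ac + bd)^2 + (ad - bc)^2 = p^2 leaves
    ad - bc = 0, as ac + bd is odd.  Otherwise p divides a d + b c, and d is replaced
    by -d. *)
Lemma two_squares_unique (p : nat) (a b c d : int) : prime p -> odd p ->
    a ^+ 2 + b ^+ 2 = p%:Z -> c ^+ 2 + d ^+ 2 = p%:Z ->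
    (2 %| a - 1)%Z -> (2 %| c - 1)%Z ->
  a ^+ 2 = c ^+ 2.
Proof.
move=> p_prime p_odd sum_ab sum_cd a_odd c_odd.
have p_gt0 : (0 < p%:Z)%R by rewrite ltz_nat prime_gt0.
wlog dvd_p : d sum_cd / (p%:Z %| a * d - b * c)%Z.
  move=> wl; have : (p%:Z %| (a * d - b * c) * (a * d + b * c))%Z.
    apply/dvdzP; exists (a ^+ 2 - c ^+ 2).
    transitivity (a ^+ 2 * d ^+ 2 - b ^+ 2 * c ^+ 2); first by ring.
    have -> : d ^+ 2 = p%:Z - c ^+ 2 by rewrite -sum_cd; ring.
    have -> : b ^+ 2 = p%:Z - a ^+ 2 by rewrite -sum_ab; ring.
    by ring.
  case/(prime_dvdzM p_prime) => dvd_p; first exact: (wl d).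
  apply: (wl (- d)); first by rewrite sqrrN.
  by rewrite mulrN -opprD dvdzE abszN -dvdzE.
have [k def_Y] := dvdzP dvd_p.
have norm_eq : (a * c + b * d) ^+ 2 + (k * p%:Z) ^+ 2 = p%:Z ^+ 2.
  by rewrite -def_Y [RHS]expr2 -{1}sum_ab -sum_cd; ring.
have X_odd : a * c + b * d != 0.
  have [q def_a] := odd_decomp a_odd; have [r def_c] := odd_decomp c_odd.
  have b_even : (2 %| b)%Z.
    have : (2 %| b ^+ 2)%Z.
      have -> : b ^+ 2 = p%:Z - a ^+ 2 by rewrite -sum_ab; ring.
      have -> : p%:Z = 2 * p./2%:Z + 1 by clear -p_odd; lia.
      by apply/dvdzP; exists (p./2%:Z - 2 * q * q - 2 * q); rewrite def_a; ring.
    by rewrite expr2 => /(@prime_dvdzM 2 _ _ isT) [].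
  have [s def_b] := dvdzP b_even.
  have -> : a * c + b * d = 2 * (2 * q * r + q + r + s * d) + 1.
    by rewrite def_a def_c def_b; ring.
  by move: (2 * q * r + q + r + s * d) => t; clear; lia.
have k0 : k = 0.
  apply/eqP; apply: contraT => k_neq0.
  have k2 : 1 <= k ^+ 2 by rewrite -gtz0_ge1 exprn_even_gt0.
  have X2 : 0 < (a * c + b * d) ^+ 2 by rewrite exprn_even_gt0.
  have : p%:Z ^+ 2 <= (k * p%:Z) ^+ 2 by rewrite exprMn ler_peMl // sqr_ge0.
  by rewrite -norm_eq gerDr leNgt X2.
have Y0 : a * d = b * c by apply/eqP; rewrite -subr_eq0 def_Y k0 mul0r.
apply: (mulIf (lt0r_neq0 p_gt0)).
rewrite -{1}sum_cd -sum_ab mulrDr -!exprMn Y0; ring.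
Qed.

Lemma mod3_products (a b : int) : exists ra rb A B C : int,
  [/\ (ra = 0 \/ ra = 1) \/ ra = 2, (rb = 0 \/ rb = 1) \/ rb = 2,
      (3 %| a - ra)%Z && (3 %| b - rb)%Z,
      a ^+ 2 = 3 * A + ra * ra & b ^+ 2 = 3 * B + rb * rb /\ a * b = 3 * C + ra * rb].
Proof.
have res c : exists r q : int, ((r = 0 \/ r = 1) \/ r = 2) /\ c = 3 * q + r.
  exists (c %% 3)%Z, (c %/ 3)%Z; split; last by rewrite mulrC -divz_eq.
  have := @modz_ge0 c 3 isT; have := @ltz_pmod c 3 isT; lia.
have [ra [qa [ra3 def_a]]] := res a; have [rb [qb [rb3 def_b]]] := res b.
exists ra, rb, (3 * qa ^+ 2 + 2 * qa * ra), (3 * qb ^+ 2 + 2 * qb * rb),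
  (3 * qa * qb + qa * rb + qb * ra); split => //.
- rewrite def_a def_b !addrK; apply/andP; split; exact: dvdz_mulr.
- by rewrite def_a; ring.
by split; rewrite ?def_a ?def_b; ring.
Qed.

(** The congruence fixes the unit d modulo 3, hence d itself: a^2 - b^2 is its real part and
    2ab or -2ab its imaginary part, all modulo 3. *)
Lemma gint_sq_mod3 (J d Z : gint) (a b n : int) :
    d \in gunits0 -> J ^+ 2 = d + 3%:R * Z ->
    gre J = a -> gim J ^+ 2 = b ^+ 2 -> a ^+ 2 + b ^+ 2 = n ->
  [/\ (3 %| n - 1)%Z -> ~~ (3 %| a)%Z -> gre (gconj d * J) = a,
      (3 %| n - 1)%Z -> (3 %| a)%Z -> gre (gconj d * J) = - a
    & (3 %| n - 2)%Z -> (3 %| a - b)%Z -> gre (- gconj d * J) = b].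
Proof.
move=> d_unit J2 reJ imJ2 norm_n.
have e3 : 3%:R * Z = Gint (3 * gre Z) (3 * gim Z).
  by apply: gint_eqP; rewrite /= ?gre_nat ?gim_nat; ring.
have re2 : a ^+ 2 - b ^+ 2 = gre d + 3 * gre Z.
  rewrite -imJ2 -reJ; have := congr1 gre J2; rewrite e3 greD /= => <-.
  by rewrite !expr2.
have im2 : 2 * (a * gim J) = gim d + 3 * gim Z.
  rewrite -reJ; have := congr1 gim J2; rewrite e3 gimD /= => <-.
  by ring.
have im_b : gim J = b \/ gim J = - b.
  by move/eqP: imJ2; rewrite eqf_sqr => /orP[]/eqP; [left | right].
have [ra [rb [A [B [C [ra3 rb3 /andP[da db] a2 [b2 ab]]]]]]] := mod3_products a b.
rewrite a2 b2 in re2 norm_n; rewrite !greM greN reJ /=.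
have {}im2 : gim J = b /\ 2 * (3 * C + ra * rb) = gim d + 3 * gim Z \/
    gim J = - b /\ - (2 * (3 * C + ra * rb)) = gim d + 3 * gim Z.
  by case: im_b => im_b; [left | right]; rewrite -im2 im_b -ab ?mulrN.
clear -d_unit re2 im2 norm_n ra3 rb3 da db.
move: (gre Z) (gim Z) (gim J) re2 im2 => zr zi j.
have {}da : exists q, a = 3 * q + ra by case/dvdzP: da => q e; exists q; rewrite mulrC -e subrK.
have {}db : exists q, b = 3 * q + rb by case/dvdzP: db => q e; exists q; rewrite mulrC -e subrK.
case: da db => [qa ->] [qb ->].
move: d_unit; rewrite !inE => /or4P[/eqP->|/eqP->|/eqP->|/orP[/eqP->|/eqP->]] /=;
  case: ra3 => [[]|] ?; case: rb3 => [[]|] ?; subst ra rb;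
  move=> re2 [] [-> im2]; split; lia.
Qed.

Definition gnorm z := gre z ^+ 2 + gim z ^+ 2.

Lemma gnormM z1 z2 : gnorm (z1 * z2) = gnorm z1 * gnorm z2.
Proof. by rewrite /gnorm greM gimM; ring. Qed.

Lemma gnorm_conj z : gnorm (gconj z) = gnorm z.
Proof. by rewrite /gnorm /= sqrrN. Qed.

Lemma gnormN z : gnorm (- z) = gnorm z.
Proof. by rewrite /gnorm greN gimN !sqrrN. Qed.

Lemma gnorm_sign n : gnorm ((-1) ^+ n) = 1.
Proof. by rewrite -signr_odd; case: (odd n). Qed.

Lemma gnorm_unit u : u \in gunits0 -> u != 0 -> gnorm u = 1.
Proof.
have : all (fun u => (u != 0) ==> (gnorm u == 1)) gunits0 by [].
by move=> /allP H /H /implyP uP /uP /eqP.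
Qed.

Lemma sign_unit n : (-1) ^+ n \in gunits0.
Proof. by rewrite -signr_odd; case: (odd n). Qed.

(** By uniqueness the real part of z is a or -a.  If z + p = 0 modulo 2 + 2i, the real part
    of z is -1 - 2m modulo 4, because p = 4m + 1 forces gim z = 2m modulo 4. *)
Lemma normalized_jacobi (p m : nat) (z : gint) (a b : int) :
    prime p -> p = (4 * m).+1 -> normal_gint (z + p%:R) -> gnorm z = p%:Z ->
    a ^+ 2 + b ^+ 2 = p%:Z -> (4 %| a - 1)%Z ->
  gre (- ((-1) ^+ m * z)) = a /\ gim (- ((-1) ^+ m * z)) ^+ 2 = b ^+ 2.
Proof.
move=> p_prime def_p /andP[]; rewrite greD gimD gre_nat gim_nat addr0 => d4 d2 norm_z sum_ab a4.
have p_odd : odd p by rewrite def_p; lia.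
have [t def_B] : exists t, gim z = 2 * t by case/dvdzP: d2 => t ->; exists t; rewrite mulrC.
have [r def_A] : exists r, gre z = 2 * r + 1.
  by apply: odd_decomp; move: d4; rewrite def_B def_p -natr1; lia.
have a2 : a ^+ 2 = gre z ^+ 2.
  apply: (two_squares_unique p_prime p_odd sum_ab norm_z); first by lia.
  by rewrite def_A addrK dvdz_mulr.
have t_m : (2 %| t - m%:Z)%Z.
  have e : m%:Z = r * (r + 1) + t * t.
    have : 4 * m%:Z + 1 = 4 * (r * (r + 1) + t * t) + 1.
      transitivity p%:Z; first by rewrite def_p; lia.
      by rewrite -norm_z /gnorm def_A def_B; ring.
    by move: (r * _ + _) => q; lia.
  have even1 (x : int) : (2 %| x * (x + 1))%Z.
    have [q [->|->]] : exists q, x = 2 * q \/ x = 2 * q + 1.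
      by exists (x %/ 2)%Z; lia.
    - by apply/dvdzP; exists (q * (2 * q + 1)); ring.
    by apply/dvdzP; exists ((2 * q + 1) * (q + 1)); ring.
  have := even1 r; have := even1 (t - 1); rewrite subrK => e1 e2.
  rewrite e (_ : t - _ = - ((t - 1) * t) - r * (r + 1)); last by ring.
  by move: ((t - 1) * t) (r * (r + 1)) e1 e2; lia.
have [s [re_s [im_s s_cases]]] : exists s : int, [/\ gre (- ((-1) ^+ m * z)) = s * gre z,
   gim (- ((-1) ^+ m * z)) = s * gim z & (s = -1 /\ ~~ odd m) \/ (s = 1 /\ odd m)].
  rewrite -signr_odd; case: (boolP (odd m)) => m_odd.
    by exists 1; rewrite expr1 mulN1r opprK !mul1r; split=> //; right.
  by exists (-1); rewrite expr0 mul1r !mulN1r; split=> //; left.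
have s2 : s ^+ 2 = 1 by case: s_cases => [[->]|[->]].
split; last first.
  rewrite im_s exprMn s2 mul1r; apply: (addrI (a ^+ 2)).
  by rewrite sum_ab a2 -norm_z.
have {}d4 : (4 %| gre z + (4 * m%:Z + 1) + 2 * t)%Z.
  by move: d4; rewrite def_B def_p; congr (_ %| _ + _ + _)%Z; lia.
rewrite re_s; move/eqP: a2; rewrite eqf_sqr => /orP[]/eqP a_z; rewrite a_z in a4 *;
  clear -d4 t_m a4 s_cases; case: s_cases => [[-> m_par]|[-> m_par]]; rewrite ?mul1r ?mulN1r //; lia.
Qed.

(** * The congruence *)

Section FinalValue.
Variables (R : comUnitRingType) (p : nat).
Hypothesis p_sq0 : p%:R * p%:R = 0 :> R.

(** The image y of the conjugate satisfies x y = p, so y^2 = 0 since x is invertible; then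
    2c x = x^2 + x y and (2c)^2 - p = x^2 + x y + y^2 agree. *)
Lemma gev_trace (iota : R) (z : gint) : iota * iota = -1 ->
  gev iota z \is a GRing.unit -> gnorm z = p%:Z ->
  gev iota z * (2 * gre z)%:~R = (4 * gre z ^+ 2 - p%:Z)%:~R.
Proof.
move=> iota_sq Uz norm_z; set x := gev iota z in Uz *; pose y := gev iota (gconj z).
have xy : x * y = p%:R.
  rewrite -gevM // (_ : z * gconj z = Gint (gnorm z) 0).
    by rewrite /gev /= norm_z mul0r addr0.
  by apply: gint_eqP; rewrite /= /gnorm; ring.
have y2 : y * y = 0.
  apply: (mulrI Uz); apply: (mulrI Uz); rewrite !mulr0.
  by transitivity (x * y * (x * y)); [ring | rewrite xy].
have trace : x + y = (2 * gre z)%:~R.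
  by rewrite /x /y -gevD /gev /= subrr mul0r addr0; congr _%:~R; ring.
rewrite rmorphB /= (_ : 4 * gre z ^+ 2 = (2 * gre z) * (2 * gre z)); last by ring.
rewrite [in RHS]rmorphM /= -trace -[p%:~R]/(p%:R) -xy.
transitivity (x * x + x * y); first by ring.
transitivity (x * x + x * y + y * y); last by ring.
by rewrite y2 addr0.
Qed.
End FinalValue.

Section Main.
Variables (p l v : nat) (a b : int).
Hypotheses (p_prime : prime p) (v_le1 : (v <= 1)%N) (def_p : p = (12 * l + 4 * v).+1).
Hypotheses (sum_ab : a ^+ 2 + b ^+ 2 = p%:Z) (a4 : (4 %| a - 1)%Z).
Let m := (3 * l + v)%N.
Let def_p4 : p = (4 * m).+1. Proof. by rewrite def_p /m; lia. Qed.

Section Ring.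
Variable R : comUnitRingType.
Hypothesis p_sq0 : p%:R * p%:R = 0 :> R.
Hypothesis unit_lt_p : forall k, (0 < k < p)%N -> (k%:R : R) \is a GRing.unit.

Local Notation bin63 k := ('C(6 * k, 3 * k) * 'C(3 * k, k))%N.

(** The number c is the real part of the Gaussian integer z whose image is the sum.  Its
    unit factor is the conjugate of d = (-1)^m chi(3) up to the sign (-1)^(l+m), which is
    1 for v = 0 and -1 for v = 1. *)
Lemma sum_bin63_value : exists c : int,
  [/\ (\sum_(k < p) (bin63 k)%:R / 864%:R ^+ k) * (2 * c)%:~R = (4 * c ^+ 2 - p%:Z)%:~R :> R,
      exists e, c ^+ 2 + e ^+ 2 = p%:Z &
      [/\ v = 0%N -> ~~ (3 %| a)%Z -> c = a,
          v = 0%N -> (3 %| a)%Z -> c = - a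
        & v = 1%N -> (3 %| a - b)%Z -> c = b]].
Proof.
have m_gt0 := m_gt0 p_prime def_p4.
have p_odd : odd p by rewrite def_p; lia.
have p_gt2 : (2 < p)%N by lia.
have [g g_prim] := Fp_prim_root p_prime def_p4.
have [w w_sq] : exists w : 'F_p, w * w = -1.
  exists (g ^+ m); have g4 := prim_expr_order g_prim.
  have : (g ^+ m * g ^+ m - 1) * (g ^+ m * g ^+ m + 1) = 0.
    transitivity (g ^+ (4 * m) - 1); last by rewrite g4 subrr.
    by rewrite (_ : 4 * m = m + m + m + m)%N; [rewrite !exprD; ring | lia].
  move/eqP; rewrite mulf_eq0 subr_eq0 addr_eq0 => /orP[|/eqP //].
  by rewrite -exprD -(prim_order_dvd g_prim) => /dvdn_leq; lia.
pose J := - ((-1) ^+ m * quartic_jacobi m w); pose d := (-1) ^+ m * quartic_char m w 3%:R.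
(* the sign -(-1)^m makes the real part of J congruent to 1 modulo 4 *)
have [re_J im_J] := normalized_jacobi p_prime def_p4 (jac_normal p_prime def_p4 w_sq)
  (jac_norm p_prime def_p4 w_sq) sum_ab a4.
rewrite -/J in re_J im_J.
have d_unit : d \in gunits0 by apply: gunits0M (sign_unit m) (chi_in m w _).
have [Z J2] : exists Z, J ^+ 2 = d + 3%:R * Z.
  have [Z jac2] := jac_sq_mod3 p_prime def_p4 w_sq.
  have psi2 : quadratic_char m w 2%:R = (-1) ^+ m := psi_two p_sq0 unit_lt_p p_prime v_le1 def_p w_sq.
  exists ((-1) ^+ m * Z); rewrite /J sqrrN exprMn sqrr_sign mul1r jac2 psi2.
  by rewrite /d mulrDr; congr (_ + _); rewrite mulrCA.
have gcases := gint_sq_mod3 d_unit J2 re_J im_J sum_ab.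
pose z := (-1) ^+ l * gconj (quartic_char m w 3%:R) * J.
have F3 : (3%:R : 'F_p) != 0 by apply: Fp_nat_neq0; lia.
have norm_z : gnorm z = p%:Z.
  rewrite /z !gnormM gnorm_sign gnorm_conj gnorm_unit ?chi_in ?(chi_neq0 p_prime def_p4 w_sq) //.
  by rewrite !mul1r /J gnormN gnormM gnorm_sign mul1r; apply: jac_norm.
have value := leg_trunc_gauss p_sq0 unit_lt_p p_prime v_le1 def_p w_sq.
rewrite -/J -/z in value.
have U2 : (2%:R : R) \is a GRing.unit by apply: unit_lt_p; lia.
have U12 := unit12 unit_lt_p v_le1 def_p (ltnW p_gt2).
have U3 := unit3 unit_lt_p v_le1 def_p (ltnW p_gt2).
exists (gre z); split.
- have -> : \sum_(k < p) (bin63 k)%:R / 864%:R ^+ k = gev (teich R w) z.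
    rewrite -value /leg_trunc; apply: eq_bigr => k _.
    have U432 : (432%:R ^+ k : R) \is a GRing.unit.
      by rewrite unitrX // (natrM R 36 12) (natrM R 3 12) !unitrM U3 U12.
    rewrite -(leg_coef_bin unit_lt_p p_prime v_le1 def_p (ltn_ord k)) (natrM R 2 432) exprMn.
    by rewrite (invrM (unitrX k U2) U432) mulrA mulrK.
  rewrite (gev_trace p_sq0) //; first exact: (iota_sq p_sq0 p_prime v_le1 def_p w_sq).
  rewrite -value (leg_trunc_value p_sq0 unit_lt_p p_prime v_le1 def_p) !unitrM eps_unit // andbT.
  rewrite !unitrX ?unitrN1 ?U3 //=.
  have : ((2 * m)`!%:R : R) \is a GRing.unit by apply: (unit_fact unit_lt_p); rewrite def_p4; clear; lia.
  have le_m2m : (m <= 2 * m)%N by rewrite leq_pmull.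
  by rewrite -(bin_fact le_m2m) natrM unitrM => /andP[].
- by exists (gim z).
have sign_conj n : gconj ((-1) ^+ n) = (-1) ^+ n by rewrite -signr_odd; case: (odd n).
have z_d : z = (-1) ^+ (l + m) * gconj d * J.
  rewrite /z /d gconjM sign_conj exprD; congr (_ * _).
  by rewrite -[RHS]mulrA (mulrA ((-1) ^+ m)) -expr2 sqrr_sign mul1r.
have [g1 g2 g3] := gcases.
have d3 : v = 0%N -> (3 %| p%:Z - 1)%Z by move=> v0; rewrite def_p v0; clear; lia.
have d3' : v = 1%N -> (3 %| p%:Z - 2)%Z by move=> v1; rewrite def_p v1; clear; lia.
have z0 : v = 0%N -> z = gconj d * J.
  by move=> v0; rewrite z_d -signr_odd (_ : odd _ = false) ?mul1r // /m v0; clear; lia.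
have z1 : v = 1%N -> z = - gconj d * J.
  by move=> v1; rewrite z_d -signr_odd (_ : odd _ = true) ?mulN1r // /m v1; clear; lia.
split=> v_eq da; first by rewrite z0 // g1 // d3.
  by rewrite z0 // g2 // d3.
by rewrite z1 // g3 // d3'.
Qed.
End Ring.
End Main.

Lemma pintegral_frac (p : nat) (x : rat) (n d : int) : coprime p `|d| ->
  x = n%:~R / d%:~R -> pintegral p x.
Proof.
rewrite /pintegral => + ->; case: divqP => [_ _|k y k0]; first by rewrite coprimen1.
by rewrite abszM coprimeMr => /andP[].
Qed.

Section TargetFractions.
Variables (F : numFieldType) (c : int) (p : nat).
Hypothesis c0 : c != 0.

Lemma target_frac :
  2 * c%:~R - p%:R / (2 * c%:~R) = (4 * c ^+ 2 - p%:Z)%:~R / (2 * c)%:~R :> F.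
Proof.
have c_F : (c%:~R : F) != 0 by rewrite intr_eq0.
by rewrite rmorphB !rmorphM ?rmorphXn /=; field.
Qed.

Lemma sum_frac (U e : nat) : U%:R / 864%:R ^+ e = U%:Z%:~R / (864 ^+ e : int)%:~R :> F.
Proof. by rewrite rmorphXn. Qed.

Lemma sum_sub_target_frac (U e : nat) (q : int) : (0 < p)%N ->
    U%:Z * (2 * c) - (4 * c ^+ 2 - p%:Z) * 864 ^+ e = q * (p ^ 2)%N%:Z ->
  (U%:R / 864%:R ^+ e - (2 * c%:~R - p%:R / (2 * c%:~R))) / p%:R ^+ 2
    = q%:~R / (864 ^+ e * (2 * c))%:~R :> F.
Proof.
move=> p_gt0 def_q.
have c_F : (c%:~R : F) != 0 by rewrite intr_eq0.
have p_F : (p%:R : F) != 0 by rewrite pnatr_eq0 -lt0n.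
have X_F : (864%:R ^+ e : F) != 0 by rewrite expf_neq0 // pnatr_eq0.
have := congr1 (fun z => z%:~R : F) def_q.
have -> : (q * (p ^ 2)%N%:Z)%:~R = q%:~R * p%:R ^+ 2 :> F by rewrite rmorphM /= -pmulrn natrX.
have -> : (U%:Z * (2 * c) - (4 * c ^+ 2 - p%:Z) * 864 ^+ e)%:~R =
   U%:R * (2 * c%:~R) - (4 * c%:~R ^+ 2 - p%:R) * 864%:R ^+ e :> F.
  by rewrite rmorphB !rmorphM rmorphB !rmorphM ?rmorphXn /=.
have -> : (864 ^+ e * (2 * c))%:~R = 864%:R ^+ e * (2 * c%:~R) :> F.
  by rewrite !rmorphM rmorphXn.
move: (864%:R ^+ e) X_F => X X_F def_qF.
apply: (mulIf (expf_neq0 2 p_F)).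
rewrite divfK ?expf_neq0 // mulrAC -def_qF; field.
by rewrite c_F X_F.
Qed.

End TargetFractions.

Lemma intr_Zp_eq0 (n : nat) (z : int) : (1 < n)%N -> z%:~R = 0 :> 'Z_n -> (n%:Z %| z)%Z.
Proof.
move=> n_gt1 z0; rewrite dvdzE /=.
have : (`|z|%N)%:R = 0 :> 'Z_n.
  by case: (intP z) z0 => [//|k|k]; rewrite ?rmorphN /= ?abszN // => /eqP; rewrite oppr_eq0 => /eqP.
by move/(congr1 val); rewrite /= val_Zp_nat // /dvdn => ->.
Qed.

Lemma prime_dvd_two_squares (p : nat) (c e : int) : prime p ->
  c ^+ 2 + e ^+ 2 = p%:Z -> coprime p `|c|.
Proof.
move=> p_prime sum_ce; rewrite prime_coprime //; apply/negP => dvd_c.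
have {}sum_ce : (`|c| ^ 2 + `|e| ^ 2 = p)%N.
  by apply/eqP; rewrite -eqz_nat -!abszX PoszD !gez0_abs ?sqr_ge0 // sum_ce.
have dvd_e : (p %| `|e|)%N.
  have : (p %| `|e| ^ 2)%N.
    by rewrite -(@dvdn_addr (`|c| ^ 2)) ?sum_ce //; apply: dvdn_exp.
  by rewrite Euclid_dvdX // => /andP[].
have : (p ^ 2 %| p)%N by rewrite -{2}sum_ce dvdn_add // dvdn_exp2r.
by move/(dvdn_leq (prime_gt0 p_prime)); have := prime_gt1 p_prime; nia.
Qed.

(** Over the common denominator 864^(p-1) the congruence in Z_p becomes a divisibility by
    p^2 between integers, which is an equation in Z/p^2. *)
Lemma congr_p2_of_Zp2 (p : nat) (c e : int) : prime p -> (3 < p)%N ->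
    c ^+ 2 + e ^+ 2 = p%:Z ->
    (\sum_(k < p) ('C(6 * k, 3 * k) * 'C(3 * k, k))%:R / 864%:R ^+ k) * (2 * c)%:~R
      = (4 * c ^+ 2 - p%:Z)%:~R :> 'Z_(p ^ 2) ->
  congr_p2 p (\sum_(0 <= k < p) ('C(6 * k, 3 * k)%:R * 'C(3 * k, k)%:R) / 864%:R ^+ k)
    (2 * c%:~R - p%:R / (2 * c%:~R)).
Proof.
move=> p_prime p_gt3 sum_ce eqZ.
have p2_gt1 : (1 < p ^ 2)%N by rewrite -{1}(exp1n 2) ltn_exp2r // prime_gt1.
have cop_c := prime_dvd_two_squares p_prime sum_ce.
have cop864 : coprime p 864.
  rewrite prime_coprime //; apply/negP.
  rewrite (_ : 864 = 2 ^ 5 * 3 ^ 3)%N // Euclid_dvdM // !Euclid_dvdX //= !dvdn_prime2 // => /orP[]/eqP p_eq; lia.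
pose U : nat := (\sum_(k < p) ('C(6 * k, 3 * k) * 'C(3 * k, k)) * 864 ^ (p.-1 - k))%N.
have sumU (R : comUnitRingType) : (864%:R : R) \is a GRing.unit ->
    \sum_(k < p) ('C(6 * k, 3 * k) * 'C(3 * k, k))%:R / 864%:R ^+ k = U%:R / 864%:R ^+ p.-1 :> R.
  move=> U864; rewrite /U natr_sum mulr_suml; apply: eq_bigr => k _.
  have le_k : (k <= p.-1)%N by have := ltn_ord k; lia.
  apply: (mulIr (unitrX p.-1 U864)); rewrite [RHS]divrK ?unitrX // -{1}(subnKC le_k) exprD mulrA.
  by rewrite divrK ?unitrX // [RHS]natrM natrX.
have c0 : c != 0 by apply: contraTneq cop_c => ->; rewrite /coprime gcdn0 neq_ltn prime_gt1 ?orbT.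
have dvd_int : ((p ^ 2)%N%:Z %| U%:Z * (2 * c) - (4 * c ^+ 2 - p%:Z) * 864 ^+ p.-1)%Z.
  apply: intr_Zp_eq0 => //.
  have U864 : (864%:R : 'Z_(p ^ 2)) \is a GRing.unit by rewrite unitZpE // coprimeXl.
  move: eqZ; rewrite sumU // => /(congr1 (fun x => x * 864%:R ^+ p.-1)).
  rewrite mulrAC divrK ?unitrX // => eqZ.
  rewrite rmorphB [X in X - _]rmorphM [X in _ - X]rmorphM rmorphXn; apply/eqP; rewrite subr_eq0.
  exact/eqP.
have [q def_q] := dvdzP dvd_int.
have U864 : (864%:R : rat) \is a GRing.unit by rewrite unitfE pnatr_eq0.
have sumQ : \sum_(0 <= k < p) ('C(6 * k, 3 * k)%:R * 'C(3 * k, k)%:R) / 864%:R ^+ k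
   = U%:R / 864%:R ^+ p.-1 :> rat.
  rewrite -(sumU _ U864) big_mkord; apply: eq_bigr => k _; congr (_ / _); exact/esym/natrM.
rewrite sumQ.
have cop_2c : coprime p `|2 * c|.
  rewrite abszM coprimeMr cop_c andbT; apply: coprime_dvdr cop864; exact: isT.
have cop_864X : coprime p `|(864 ^+ p.-1 : int)| by rewrite abszX coprimeXr.
split.
- apply: (@pintegral_frac p _ U%:Z (864 ^+ p.-1) cop_864X).
  exact: sum_frac.
- exact: (pintegral_frac cop_2c (target_frac _ _ c0)).
apply: (@pintegral_frac p _ q (864 ^+ p.-1 * (2 * c))).
  by rewrite abszM coprimeMr cop_864X cop_2c.
exact: (sum_sub_target_frac _ c0 (prime_gt0 p_prime) def_q).
Qed.

Theorem theorem3p2 (p : nat) (a b : int)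
    (p_prime : prime p)
    (p_mod4 : p = 1 %[mod 4])
    (p_sum : p%:Z = a ^+ 2 + b ^+ 2)
    (a_mod4 : (4 %| a - 1)%Z) :
  let S : rat :=
    \sum_(0 <= k < p)
      ('C(6 * k, 3 * k)%:R * 'C(3 * k, k)%:R) / 864%:R ^+ k in
  [/\ p = 1 %[mod 12] -> ~~ (3 %| a)%Z ->
        congr_p2 p S (2 * a%:~R - p%:R / (2 * a%:~R)),
      p = 1 %[mod 12] -> (3 %| a)%Z ->
        congr_p2 p S (- (2 * a%:~R) + p%:R / (2 * a%:~R))
    & p = 5 %[mod 12] -> (3 %| a - b)%Z ->
        congr_p2 p S (2 * b%:~R - p%:R / (2 * b%:~R))].
Proof.
move=> S; have p_gt3 : (3 < p)%N.
  by have := prime_gt1 p_prime; move: p_mod4; case: p {p_prime p_sum S} => [|[|[|[|p]]]].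
have p2_gt1 : (1 < p ^ 2)%N by rewrite -{1}(exp1n 2) ltn_exp2r // prime_gt1.
have p_sq0 : p%:R * p%:R = 0 :> 'Z_(p ^ 2) by rewrite -natrM mulnn pchar_Zp.
have unit_lt_p k : (0 < k < p)%N -> (k%:R : 'Z_(p ^ 2)) \is a GRing.unit.
  move=> /andP[k_gt0 lt_kp]; rewrite unitZpE // coprimeXl // prime_coprime //.
  by apply/negP => /(dvdn_leq k_gt0); rewrite leqNgt lt_kp.
have value l v (v1 : (v <= 1)%N) (p_lv : p = (12 * l + 4 * v).+1) :=
  sum_bin63_value p_prime v1 p_lv (esym p_sum) a_mod4 p_sq0 unit_lt_p.
split=> p_mod12 div3.
- have [|c [eqZ [e sum_ce] [c_val _ _]]] := value (p %/ 12)%N 0%N isT; first by lia.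
  by rewrite -(c_val erefl div3); apply: congr_p2_of_Zp2 sum_ce eqZ.
- have [|c [eqZ [e sum_ce] [_ c_val _]]] := value (p %/ 12)%N 0%N isT; first by lia.
  have -> : - (2 * a%:~R) + p%:R / (2 * a%:~R) = 2 * c%:~R - p%:R / (2 * c%:~R) :> rat.
    by rewrite (c_val erefl div3) rmorphN mulrN invrN mulrN opprK.
  exact: congr_p2_of_Zp2 sum_ce eqZ.
have [|c [eqZ [e sum_ce] [_ _ c_val]]] := value (p %/ 12)%N 1%N isT; first by lia.
by rewrite -(c_val erefl div3); apply: congr_p2_of_Zp2 sum_ce eqZ.
Qed.
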